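(* Let $k\ge2$ and $\ell,m\ge0$ be integers. Then the set \[ \mathcal{A}_{\ell,m}^{(k)}:=\Big\{n\in\mathbb{Z}_{\ge1}\ \Big|\ \#\big((n^k,(n+1)^k)\cap\mathcal{S}_k\big)=\ell,\ \#\big(((n+1)^k,(n+2)^k)\cap\mathcal{S}_k\big)=m\Big\} \] has positive asymptotic density \[ d(\mathcal{A}_{\ell,m}^{(k)})=\sum_{\substack{\mathcal{I},\mathcal{J}\subseteq\Lambda_k\\ \#\mathcal{I}=\ell,\ \#\mathcal{J}=m,\ \mathcal{I}\cap\mathcal{J}=\varnothing}}\ \prod_{\lambda\in\mathcal{I}\cup\mathcal{J}}\frac{1}{\lambda}\cdot\prod_{\lambda\in\Lambda_k\setminus(\mathcal{I}\cup\mathcal{J})}\Big(1-\frac{2}{\lambda}\Big), \] i.e. $d(\mathcal{A}_{\ell,m}^{(k)})=\sum d(\mathcal{B}_{\mathcal{I},\mathcal{J}}^{(k)})$ over the same index set.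
   Context: Let $k\ge2$ be an integer. A positive integer $n$ is $k$-full if $p^k\mid n$ for every prime $p\mid n$. Let $\mathcal{S}_k$ be the set of $k$-full integers that are not perfect $k$th powers. Define \[ \Lambda_k:=\Big\{(b_1^{k+1}b_2^{k+2}\cdots b_{k-1}^{2k-1})^{1/k}\ \Big|\ b_1,\dots,b_{k-1}\in\mathbb{Z}_{\ge1},\ b_1\cdots b_{k-1}\ge2,\ b_1\cdots b_{k-1}\text{ squarefree}\Big\}. \] For nonempty $\mathcal{I}\subseteq\Lambda_k$ let $\mathcal{S}_{\mathcal{I}}:=\{a^k\lambda^k\mid a\in\mathbb{Z}_{\ge1},\lambda\in\mathcal{I}\}$, and $\mathcal{S}_\varnothing:=\varnothing$. For disjoint finite $\mathcal{I},\mathcal{J}\subseteq\Lambda_k$, $\mathcal{B}_{\mathcal{I},\mathcal{J}}^{(k)}$ is the set of $n\ge1$ with $\#((n^k,(n+1)^k)\cap\mathcal{S}_{\mathcal{I}})=\#\mathcal{I}$, $\#(((n+1)^k,(n+2)^k)\cap\mathcal{S}_{\mathcal{J}})=\#\mathcal{J}$ and $(n^k,(n+2)^k)\cap\mathcal{S}_{\Lambda_k\setminus(\mathcal{I}\cup\mathcal{J})}=\varnothing$. For $\mathcal{A}\subseteq\mathbb{Z}_{\ge1}$, $\#\mathcal{A}(x)$ counts its elements $\le x$ and $d(\mathcal{A}):=\lim_{x\to\infty}\#\mathcal{A}(x)/x$ when it exists. *)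

(* Defs.v *)
From HB Require Import structures.
From mathcomp Require Import all_boot all_order all_algebra.
From mathcomp Require Import finmap.
From mathcomp Require Import boolp classical_sets fsbigop reals ereal topology
  normedtype sequences esum exp.
Set Implicit Arguments. Unset Strict Implicit. Unset Printing Implicit Defensive.
Import Order.TTheory GRing.Theory Num.Theory.
Import numFieldNormedType.Exports.
Local Open Scope classical_set_scope.
Local Open Scope ring_scope.

Definition kfull (k n : nat) : Prop :=
  (0 < n)%N /\ forall p, prime p -> (p %| n)%N -> (p ^ k %| n)%N.

Definition Sk (k n : nat) : Prop := kfull k n /\ ~ (exists a : nat, n = (a ^ k)%N).

Definition squarefree (n : nat) : Prop := forall p, prime p -> ~~ (p * p %| n)%N.

Definition Lambda (R : realType) (k : nat) : set R :=
  [set x | exists b : nat -> nat,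
     (forall i, (1 <= i < k)%N -> (0 < b i)%N) /\
     (2 <= \prod_(1 <= i < k) b i)%N /\
     squarefree (\prod_(1 <= i < k) b i) /\
     x = ((\prod_(1 <= i < k) b i ^ (k + i))%N%:R) `^ (k%:R^-1)].

Definition S_of (R : realType) (k : nat) (L : set R) (j : nat) : Prop :=
  exists a : nat, (0 < a)%N /\ exists2 l, L l & j%:R = (a%:R * l) ^+ k.

Definition cnt_open (a b : nat) (P : nat -> Prop) : nat :=
  count (fun j => `[< P j >]) (iota a.+1 (b - a.+1)).

Definition Aset (k l m : nat) (n : nat) : Prop :=
  (1 <= n)%N /\
  cnt_open (n ^ k) (n.+1 ^ k) (Sk k) = l /\
  cnt_open (n.+1 ^ k) (n.+2 ^ k) (Sk k) = m.

Definition Bset (R : realType) (k : nat) (I J : {fset R}) (n : nat) : Prop :=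
  (1 <= n)%N /\
  cnt_open (n ^ k) (n.+1 ^ k) (S_of k [set` I]) = #|` I|%fset /\
  cnt_open (n.+1 ^ k) (n.+2 ^ k) (S_of k [set` J]) = #|` J|%fset /\
  (forall j, (n ^ k < j < n.+2 ^ k)%N ->
     ~ S_of k (@Lambda R k `\` ([set` I] `|` [set` J])) j).

Definition has_density (R : realType) (A : nat -> Prop) (d : R) : Prop :=
  (fun N : nat => (count (fun j => `[< A j >]) (iota 1 N))%:R / N%:R) @ \oo --> d.

(* prod_{lambda in Lambda_k \ F} (1 - 2/lambda), as the limit of the partial
   products over the (finite) sets { lambda in Lambda_k \ F | lambda <= X } *)
Definition tail_prod (R : realType) (k : nat) (F : set R) : R :=
  limn (fun X : nat =>
    \big[*%R/1%R]_(l \in (@Lambda R k `\` F) `&` [set y | y <= X%:R]) (1 - 2 / l)).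

Definition term (R : realType) (k : nat) (I J : {fset R}) : R :=
  (\prod_(l <- (I `|` J)%fset) l^-1) * tail_prod k ([set` I] `|` [set` J]).

Definition IJpairs (R : realType) (k l m : nat) : set ({fset R} * {fset R}) :=
  [set IJ | [set` IJ.1] `<=` @Lambda R k /\ [set` IJ.2] `<=` @Lambda R k /\
            #|` IJ.1|%fset = l /\ #|` IJ.2|%fset = m /\
            [disjoint IJ.1 & IJ.2]%fset].

(* Main.v *)
Require Import Defs.
From HB Require Import structures.
From mathcomp Require Import all_boot all_order all_algebra.
From mathcomp Require Import finmap.
From mathcomp Require Import boolp classical_sets fsbigop reals ereal topology
  normedtype sequences esum exp.
From mathcomp Require Import closed_field cardinality trigo lra zify.
Import Order.TTheory GRing.Theory Num.Theory.
Import numFieldNormedType.Exports.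
Local Open Scope classical_set_scope.
Local Open Scope ring_scope.
Set Implicit Arguments. Unset Strict Implicit. Unset Printing Implicit Defensive.

(* Write hits n for the set of lambda in Lambda_k having a multiple strictly
   between n and n+1. Since every lambda exceeds 2 and the numbers a * lambda are
   irrational and pairwise distinct, the k-full non-powers in (n^k, (n+1)^k)
   correspond to the elements of hits n, and everything is expressed by the pair
   P n = (hits n, hits n.+1).
   For finitely many lambda, whether lambda lies in hits n or in hits n.+1 depends
   on the fractional part of n / lambda. The numbers 1 and 1 / lambda are linearly
   independent over Q: an irrational positive real x with x^k rational has trace 0
   on any finite-dimensional Q-space stable under x, so dividing a relation by one
   of its terms and taking traces kills the coefficient of that term. By Weyl's
   theorem the fractional parts are therefore jointly equidistributed.
   As the sum of 1 / lambda converges, the n affected by some lambda > X have small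
   upper density. Letting X grow gives the density of P n = (I, J), and the same
   tightness allows summing over all pairs (I, J). *)

(** * Linear independence of real radicals *)

(** Equidistribution is used only through lower bounds for boxes: the three positions of n relative
    to a lambda partition the integers and their lengths add up to 1, so the lower bounds force
    equality and no approximation of boxes from above is made. Weyl sums are written with real
    cosines carrying a phase, which covers sines as well. Ratios of distinct lambda are irrational
    because the prime exponents in lambda^k are determined by their residues modulo k. The bound
    lambda > 2 keeps the intervals for [hits n] and [hits n.+1] disjoint inside [0, 1) and makes
    every factor 1 - 2 / lambda positive. The sum of 1 / lambda converges because lambda is a
    product of powers b_i^(1 + i/k) with exponents above 1; this also makes the infinite products
    positive. *)

Definition is_rat (R : realFieldType) (x : R) := exists q : rat, x = ratr q.

(** Every root z of [f] in an algebraic closure satisfies z^d = c, and f(0) over the leading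
    coefficient is the product of these roots up to sign. Taking the absolute value in Q removes the
    sign, so no modulus on the closure is involved. *)
Lemma divisor_binomial_norm (d : nat) (c : rat) (f : {poly rat}) :
  (0 < d)%N -> 0 < c -> f %| 'X^d - c%:P ->
  exists2 q : rat, 0 <= q & q ^+ d = c ^+ (size f).-1.
Proof.
move=> d0 c0 fdiv.
have mu0 : 'X^d - c%:P != 0 :> {poly rat}.
  by rewrite -size_poly_gt0 size_XnsubC.
have f0 : f != 0 by apply: contraTneq fdiv => ->; rewrite dvd0p.
have lf0 : lead_coef f != 0 by rewrite lead_coef_eq0.
exists `|f`_0 / lead_coef f|; first exact: normr_ge0.
have [K [iota _]] := countable_algebraic_closure rat.
pose F := map_poly iota f.
have lF0 : lead_coef F != 0 by rewrite lead_coef_eq0 map_poly_eq0.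
have [r Dr] := closed_field_poly_normal F.
have Fdiv : F %| 'X^d - (iota c)%:P.
  have -> : 'X^d - (iota c)%:P = map_poly iota ('X^d - c%:P).
    by rewrite rmorphB /= map_polyXn map_polyC.
  by rewrite dvdp_map.
have szr : size r = (size f).-1.
  have : size F = size f by rewrite size_map_poly.
  by rewrite Dr size_scale // size_prod_XsubC => <-.
have rootr z : z \in r -> z ^+ d = iota c.
  move=> zr; have : root F z by rewrite Dr rootZ // root_prod_XsubC.
  rewrite -dvdp_XsubCl => /dvdp_trans /(_ Fdiv).
  by rewrite dvdp_XsubCl /root !hornerE subr_eq0 => /eqP.
have E : (f`_0 / lead_coef f) ^+ d = ((-1) ^+ d * c) ^+ (size f).-1.
  apply: (fmorph_inj iota); rewrite rmorphXn [RHS]rmorphXn.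
  rewrite (rmorphM iota ((-1) ^+ d)) rmorphXn rmorphN1 -szr.
  have -> : iota (f`_0 / lead_coef f) = F`_0 / lead_coef F.
    by rewrite coef_map lead_coef_map /= -fmorph_div.
  have -> : F`_0 / lead_coef F = \prod_(z <- r) (- z).
    rewrite Dr lead_coefZ (monicP (monic_prod_XsubC _ _ _)) mulr1 -horner_coef0.
    rewrite hornerZ mulrAC divff ?mul1r //.
    by rewrite horner_prod; apply: eq_bigr => z _; rewrite !hornerE.
  rewrite -prodrXl big_seq (eq_bigr (fun=> (-1) ^+ d * iota c)) -?big_seq; last first.
    by move=> z /rootr <-; rewrite [LHS]exprNn.
  by rewrite big_const_seq count_predT -Monoid.iteropE.
by rewrite -normrX E normrX normrM normrX normrN1 expr1n mul1r gtr0_norm.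
Qed.

(* A factor of degree e of X^d - c has constant term of absolute value x^e,
   because all its complex roots have the same modulus x. *)
Lemma irreducible_binomial (R : realFieldType) (x : R) (d : nat) (c : rat) :
  (0 < d)%N -> 0 < x -> x ^+ d = ratr c ->
  (forall e, (0 < e < d)%N -> ~ is_rat (x ^+ e)) ->
  irreducible_poly ('X^d - c%:P).
Proof.
move=> d0 x0 xd mind.
have c0 : 0 < c by rewrite -(ltr0q R) -xd exprn_gt0.
split; first by rewrite size_XnsubC.
move=> f szf fdiv.
have mu0 : 'X^d - c%:P != 0 :> {poly rat} by rewrite -size_poly_gt0 size_XnsubC.
have f0 : f != 0 by apply: contraTneq fdiv => ->; rewrite dvd0p.
have [q q0 qd] := divisor_binomial_norm d0 c0 fdiv.
(* Two nonnegative reals with the same [d]th power; a degree strictly between 0 and d would now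
   contradict [mind]. *)
have xe : x ^+ (size f).-1 = ratr q.
  apply: (@pexpIrn _ d) => //; rewrite ?nnegrE ?exprn_ge0 ?ler0q //; first exact: ltW.
  by rewrite -exprM mulnC exprM xd -!rmorphXn /= qd.
have szle := dvdp_leq mu0 fdiv.
rewrite -dvdp_size_eqp // size_XnsubC //.
move: szle; rewrite size_XnsubC // => szle.
have sf : (0 < size f)%N by rewrite size_poly_gt0.
apply: contraT => ne; exfalso.
apply: (mind (size f).-1); last by exists q.
move: szf ne szle sf; case: (size f) => [|[|s]] //= _ ne; rewrite ltnS => ? _.
by rewrite ltn_neqAle; apply/andP; split.
Qed.

(** A root of [p] is shared with [mu], so their gcd is not constant and irreducibility makes [mu]
    divide [p]. Dividing it out lowers the size. *)
Lemma poly_eqp_expn (F : fieldType) (K : closedFieldType)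
    (iota : {rmorphism F -> K}) (p mu : {poly F}) :
  irreducible_poly mu -> p != 0 ->
  (forall z, root (map_poly iota p) z -> root (map_poly iota mu) z) ->
  exists s, p %= mu ^+ s.
Proof.
move=> [szmu irr]; move: {2}(size p) (leqnn (size p)) => n.
elim: n p => [|n IH] p; first by rewrite leqn0 size_poly_eq0 => ->.
move=> szp p0 rts.
have [sz1|sz1] := eqVneq (size p) 1%N.
  by exists 0%N; rewrite expr0 -size_poly_eq1 sz1.
have : size (map_poly iota p) != 1%N by rewrite size_map_poly.
move=> /closed_rootP [z rz].
have := rts _ rz; move: (rz); rewrite -!dvdp_XsubCl => d1 d2.
have : 'X - z%:P %| map_poly iota (gcdp p mu) by rewrite gcdp_map dvdp_gcd d1.
move=> dg.
have mu0 : mu != 0 by rewrite -size_poly_gt0 (ltn_trans _ szmu).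
have szg : size (gcdp p mu) != 1%N.
  have g0 : gcdp p mu != 0 by rewrite gcdp_eq0 negb_and p0.
  have := dvdp_leq _ dg; rewrite map_poly_eq0 => /(_ g0).
  by rewrite size_XsubC size_map_poly => h; apply/eqP => e; rewrite e in h.
have gm := irr _ szg (dvdp_gcdr p mu).
have mp : mu %| p by rewrite -(eqp_dvdl _ gm) dvdp_gcdl.
have pE := divpK mp.
set q := p %/ mu in pE.
have q0 : q != 0 by apply: contraNneq p0 => q0; rewrite -pE q0 mul0r.
have [||s hs] := IH q _ q0.
- move: szp; rewrite -pE size_mul // => h.
  move: szmu h; case: (size mu) => [|[|m]] // _; rewrite !addnS /= ltnS.
  by apply: leq_trans; rewrite leq_addr.
- by move=> w rw; apply: rts; rewrite -pE rmorphM /= rootM rw.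
by exists s.+1; rewrite -pE exprSr eqp_mul2r.
Qed.

(* The characteristic polynomial of M is a power of X^d - c, hence a polynomial in
   X^d, so its second coefficient vanishes. *)
Lemma trace_radical0 (n d : nat) (M : 'M[rat]_n.+1) (c : rat) :
  (1 < d)%N -> irreducible_poly ('X^d - c%:P) -> M ^+ d = c%:M -> \tr M = 0.
Proof.
move=> d1 irr Md.
have cp0 : char_poly M != 0 by rewrite monic_neq0 ?char_poly_monic.
have [K [iota _]] := countable_algebraic_closure rat.
have [|s eqs] := poly_eqp_expn (iota := iota) irr cp0.
  move=> z; rewrite map_char_poly -eigenvalue_root_char => /eigenvalueP[v vM v0].
  have vMj j : v *m (map_mx iota M) ^+ j = z ^+ j *: v.
    elim: j => [|j IH]; first by rewrite !expr0 scale1r mulmx1.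
    by rewrite exprSr -mulmxE mulmxA IH -scalemxAl vM scalerA -exprSr.
  have MdC : map_mx iota M ^+ d = (iota c)%:M.
    by rewrite -rmorphXn /= Md map_scalar_mx.
  move: (vMj d); rewrite MdC mul_mx_scalar.
  move=> /eqP; rewrite -subr_eq0 -scalerBl scaler_eq0 (negPf v0) orbF subr_eq0 => /eqP e.
  by rewrite rmorphB /= map_polyXn map_polyC /= /root !hornerE e subrr.
have := char_poly_trace M isT.
have /eqpP[[u v] /andP[/= u0 v0] E] := eqs.
have sz : (n.+1 = d * s)%N.
  have := size_char_poly M; rewrite (eqp_size eqs).
  have := size_exp ('X^d - c%:P) s; rewrite size_XnsubC ?(ltnW d1) //= => h.
  have : (0 < size (('X^d - c%:P) ^+ s : {poly rat}))%N.
    by rewrite -(eqp_size eqs) size_poly_gt0.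
  by case: (size _) h => //= m -> _ [].
have -> : char_poly M = (v / u) *: (('X - c%:P) ^+ s \Po 'X^d).
  rewrite rmorphXn /= comp_polyB comp_polyX comp_polyC mulrC -scalerA -E scalerA.
  by rewrite mulVf ?scale1r.
(* The trace sits in the coefficient of index n, which vanishes in a polynomial in X^d: d divides n
   + 1 and d > 1, so d does not divide n. *)
rewrite coefZ coef_comp_poly_Xn ?(ltnW d1) // ifF ?mulr0; last first.
  apply/negP => /= dn; have : (d %| n.+1)%N by rewrite sz dvdn_mulr.
  by rewrite -addn1 dvdn_addr // dvdn1 => /eqP d1'; rewrite d1' in d1.
by move=> /eqP; rewrite eq_sym oppr_eq0 => /eqP.
Qed.

Section RationalSpan.
Variable R : realFieldType.

Definition qindep n (t : 'cV[R]_n) :=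
  forall u : 'rV[rat]_n, map_mx ratr u *m t = 0 -> u = 0.

Definition qspan n (t : 'cV[R]_n) (y : R) :=
  exists u : 'rV[rat]_n, map_mx ratr u *m t = y%:M.

Lemma qspanZ n (t : 'cV[R]_n) q y : qspan t y -> qspan t (ratr q * y).
Proof.
move=> [u hu]; exists (q *: u).
by rewrite map_mxZ /= -scalemxAl hu scale_scalar_mx.
Qed.

(** An entry is adjoined only when it lies outside the span so far. Since the basis consists of
    entries of [s], stability of [s] under multiplication passes to it. *)
Lemma qindep_basis (s : seq R) : exists n (t : 'cV[R]_n),
  [/\ qindep t, forall y, y \in s -> qspan t y & forall i, t i 0 \in s].
Proof.
elim: s => [|y s [n [t [indt spt tin]]]].
  by exists 0%N, 0; split=> // [u _|[]//]; apply/matrixP => ? [].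
have [hy|hy] := pselect (qspan t y).
  exists n, t; split=> // [z|i]; last by rewrite inE tin orbT.
  by rewrite inE => /predU1P[->|/spt].
exists (n + 1)%N, (col_mx t y%:M); split.
- move=> u; rewrite -[u]hsubmxK; set u1 := lsubmx u; set u2 := rsubmx u.
  rewrite map_row_mx mul_row_col => h.
  have u20 : u2 = 0.
    apply: contrapT => u2n; apply: hy.
    pose q := u2 0 0.
    have q0 : q != 0.
      by apply/eqP => q0; apply: u2n; apply/matrixP => i j; rewrite !ord1 -/q q0 mxE.
    exists (- q^-1 *: u1); rewrite map_mxZ -scalemxAl.
    move/eqP: h; rewrite addr_eq0 => /eqP ->.
    rewrite [u2]mx11_scalar -/q map_scalar_mx -scalar_mxM scalerN -scaleNr.
    rewrite scale_scalar_mx rmorphN opprK mulrA -rmorphM /= mulVf // rmorph1.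
    by rewrite mul1r.
  move: h; rewrite u20 map_mx0 mul0mx addr0 => /indt ->.
  by rewrite row_mx0.
- move=> z; rewrite inE => /predU1P[->|/spt[u hu]].
    by exists (row_mx 0 1%:M); rewrite map_row_mx mul_row_col map_mx0 mul0mx add0r map_mx1 mul1mx.
  by exists (row_mx u 0); rewrite map_row_mx mul_row_col hu map_mx0 mul0mx addr0.
- move=> i; rewrite mxE inE; case: splitP => j _; rewrite ?tin ?orbT //.
  by rewrite !ord1 mxE mulr1n eqxx.
Qed.

(** Take all monomials in [xs] with exponents below k: an exponent that reaches k is replaced by the
    rational factor x^k. *)
Lemma stable_monomials (k : nat) (xs : seq R) : (0 < k)%N ->
  (forall x, x \in xs -> is_rat (x ^+ k)) ->
  exists s : seq R, 1 \in s /\ forall x y, x \in xs -> y \in s ->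
    exists q : rat, exists2 z, z \in s & x * y = ratr q * z.
Proof.
move=> k0; elim: xs => [|x xs IH] hx; first by exists [:: 1]; rewrite inE.
have [|s [s1 hs]] := IH; first by move=> z hz; apply: hx; rewrite inE hz orbT.
exists [seq y * x ^+ e | y <- s, e <- iota 0 k]; split.
  by apply/allpairsP; exists (1, 0%N); rewrite /= s1 mem_iota expr0 mulr1 k0.
move=> w y; rewrite inE => /predU1P[->|wx] /allpairsP[[z e] /= [zs]].
  rewrite mem_iota /= add0n => ek ->.
  have [ek'|ek'] := ltnP e.+1 k.
    exists 1, (z * x ^+ e.+1).
      by apply/allpairsP; exists (z, e.+1); rewrite /= zs mem_iota.
    by rewrite rmorph1 mul1r mulrCA -exprS.
  have [q hq] := hx x (mem_head _ _).
  exists q, z; first by apply/allpairsP; exists (z, 0%N); rewrite /= zs mem_iota k0 expr0 mulr1.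
  by rewrite mulrCA -exprS -hq mulrC; congr (x ^+ _ * _); apply/eqP; rewrite eqn_leq ek.
rewrite mem_iota /= => ek ->; have [q [v vs hv]] := hs _ _ wx zs.
exists q, (v * x ^+ e); last by rewrite mulrA hv mulrA.
by apply/allpairsP; exists (v, e); rewrite /= vs mem_iota.
Qed.

(** [M] is the rational matrix of multiplication by [x] on the Q-span of the entries of [t]. *)
Definition has_mult_mx n (t : 'cV[R]_n) (x : R) :=
  exists M : 'M[rat]_n, map_mx ratr M *m t = x *: t.

Lemma has_mult_mxM n (t : 'cV[R]_n) x y :
  has_mult_mx t x -> has_mult_mx t y -> has_mult_mx t (x * y).
Proof.
move=> [M hM] [N hN]; exists (M *m N).
by rewrite map_mxM -mulmxA hN -scalemxAr hM scalerA mulrC.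
Qed.

Lemma has_mult_mx_rat n (t : 'cV[R]_n) q : has_mult_mx t (ratr q).
Proof. by exists q%:M; rewrite map_scalar_mx mul_scalar_mx. Qed.

Lemma has_mult_mxX n (t : 'cV[R]_n) x j : has_mult_mx t x -> has_mult_mx t (x ^+ j).
Proof.
move=> hx; elim: j => [|j IH]; last by rewrite exprS; apply: has_mult_mxM.
by rewrite expr0 -(rmorph1 (ratr : {rmorphism rat -> R})); apply: has_mult_mx_rat.
Qed.

Lemma mult_mx_eq n (t : 'cV[R]_n) (M N : 'M[rat]_n) : qindep t ->
  map_mx ratr M *m t = map_mx ratr N *m t -> M = N.
Proof.
move=> indt e; apply/eqP; rewrite -subr_eq0; apply/eqP/row_matrixP => i.
rewrite row0; apply: indt.
rewrite map_row -row_mul map_mxB mulmxBl e subrr.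
by apply/matrixP => a b; rewrite !mxE.
Qed.

(** The least d with x^d rational exceeds 1, and its minimality makes X^d - c irreducible.
    Independence of [t] turns x^d = c into the matrix identity M^d = c. *)
Lemma trace_mult_mx0 n (t : 'cV[R]_n.+1) (x : R) k (M : 'M[rat]_n.+1) :
  (0 < k)%N -> 0 < x -> is_rat (x ^+ k) -> ~ is_rat x -> qindep t ->
  map_mx ratr M *m t = x *: t -> \tr M = 0.
Proof.
move=> k0 x0 xk xr indt hM.
have exd : exists d, (0 < d)%N && asbool (is_rat (x ^+ d)).
  by exists k; rewrite k0 asboolT.
case: (ex_minnP exd) => d /andP[d0 /asboolP [c hc]] dmin.
have d1 : (1 < d)%N.
  rewrite ltn_neqAle d0 andbT; apply/eqP => d1.
  by apply: xr; exists c; rewrite -hc -d1 expr1.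
apply: (@trace_radical0 n d M c d1).
  apply: (irreducible_binomial d0 x0 hc) => e /andP[e0 ed] re.
  by have := dmin e; rewrite e0 asboolT // leqNgt ed => /(_ isT).
apply: (mult_mx_eq indt); rewrite rmorphXn /= map_scalar_mx mul_scalar_mx /= -hc.
have MX j : map_mx ratr M ^+ j *m t = x ^+ j *: t.
  elim: j => [|j IH]; first by rewrite !expr0 scale1r mul1mx.
  by rewrite exprS -mulmxE -mulmxA IH -scalemxAr hM scalerA -exprSr.
exact: MX.
Qed.

Theorem radicals_qindep (k : nat) (s : seq R) (q : R -> rat) :
  (0 < k)%N -> uniq s -> (forall x, x \in s -> 0 < x) ->
  (forall x, x \in s -> is_rat (x ^+ k)) ->
  (forall x y, x \in s -> y \in s -> x != y -> ~ is_rat (x / y)) ->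
  \sum_(x <- s) ratr (q x) * x = 0 ->
  forall x, x \in s -> q x = 0.
Proof.
move=> k0 us s0 sk sr rel x xs.
have [w [w1 hw]] := stable_monomials k0 sk.
have [[|n] [t [indt spt tin]]] := qindep_basis w.
  have [u /matrixP /(_ 0 0)] := spt _ w1.
  by rewrite !mxE big_ord0 => /eqP; rewrite eq_sym oner_eq0.
have mm y : y \in s -> has_mult_mx t y.
  move=> ys.
  have row_ex i : exists u : 'rV[rat]_n.+1, map_mx ratr u *m t = (y * t i 0)%:M.
    have [p [z zw ->]] := hw _ _ ys (tin i).
    by apply: qspanZ; apply: spt.
  have [u hu] := choice row_ex.
  exists (\matrix_i u i); apply/row_matrixP => i.
  rewrite row_mul -map_row rowK hu.
  by apply/matrixP => a b; rewrite !mxE !ord1 mulr1n.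
have mmr y : y \in s -> has_mult_mx t (y / x).
  move=> ys; apply: has_mult_mxM; first exact: mm.
  have [c hc] := sk _ xs; have x0 : x != 0 by rewrite gt_eqF ?s0.
  (* Since x^k = c is rational, division by x is multiplication by x^(k-1) / c, so it is given by a
     matrix too. *)
  have -> : x^-1 = ratr c^-1 * x ^+ k.-1.
    rewrite fmorphV /= -hc -{1}(prednK k0) exprS invfM -mulrA mulVf ?mulr1 //.
    by rewrite expf_neq0.
  by apply: has_mult_mxM; [exact: has_mult_mx_rat|apply: has_mult_mxX; apply: mm].
have mmr' y : exists M : 'M[rat]_n.+1, y \in s -> map_mx ratr M *m t = (y / x) *: t.
  have [ys|ys] := boolP (y \in s); last by exists 0.
  by have [M hM] := mmr y ys; exists M.
have [M hM] := choice mmr'.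
have x0 : x != 0 by rewrite gt_eqF ?s0.
have sumM : \sum_(y <- s) q y *: M y = 0.
  apply: (mult_mx_eq indt); rewrite raddf_sum /= map_mx0 mul0mx mulmx_suml.
  rewrite big_seq (eq_bigr (fun y => (ratr (q y) * y) *: (x^-1 *: t))); last first.
    by move=> y ys; rewrite map_mxZ /= -scalemxAl hM // !scalerA mulrA.
  by rewrite -big_seq -scaler_suml rel scale0r.
have Mx : M x = 1%:M.
  by apply: (mult_mx_eq indt); rewrite hM // map_mx1 mul1mx divff // scale1r.
(* Only y = x survives in the trace, where [M x] is the identity of nonzero trace n + 1. *)
have := congr1 mxtrace sumM; rewrite raddf_sum /= (bigD1_seq x) //= raddf0.
rewrite big_seq_cond big1 ?addr0; last first.
  move=> y /andP[ys yx]; rewrite mxtraceZ; apply/eqP; rewrite mulf_eq0; apply/orP; right; apply/eqP.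
  apply: (@trace_mult_mx0 n t (y / x) k) => //; last by apply: hM.
  - by rewrite divr_gt0 ?s0.
  - have [c hc] := sk _ ys; have [c' hc'] := sk _ xs.
    by exists (c / c'); rewrite fmorph_div /= expr_div_n hc hc'.
  - exact: sr.
rewrite mxtraceZ Mx mxtrace1 => /eqP; rewrite mulf_eq0 => /orP[/eqP //|].
by rewrite pnatr_eq0.
Qed.

End RationalSpan.

(** * Means of trigonometric polynomials *)

Section Trigonometry.
Variable R : realType.
Implicit Types (x y : R) (m : int).

Definition cos1 (y : R) : R := cos (pi *+ 2 * y).

Lemma norm_sinDpi_int x m : `|sin (x + pi * m%:~R)| = `|sin x|.
Proof.
have nat_case (n : nat) (z : R) : `|sin (z + pi * n%:R)| = `|sin z|.
  elim: n => [|n IH]; first by rewrite mulr0 addr0.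
  by rewrite -natr1 mulrDr mulr1 addrA sinDpi normrN.
case: m => n; first exact: nat_case.
by rewrite NegzE mulrNz -(nat_case n.+1) mulrN subrK.
Qed.

Lemma cos1Dint y m : cos1 (y + m%:~R) = cos1 y.
Proof.
have nat_case (n : nat) (z : R) : cos1 (z + n%:R) = cos1 z.
  elim: n => [|n IH]; first by rewrite addr0.
  by rewrite /cos1 -natr1 addrA mulrDr mulr1 cosD2pi.
case: m => n; first exact: nat_case.
by rewrite NegzE mulrNz -(nat_case n.+1) subrK.
Qed.

Definition frac (y : R) : R := y - (Num.floor y)%:~R.

Lemma frac_ge0 y : 0 <= frac y.
Proof. by rewrite subr_ge0 real_floor_le ?num_real. Qed.

Lemma frac_lt1 y : frac y < 1.
Proof. by rewrite ltrBlDl -[1]/(1%:~R) -intrD real_floorD1_gt ?num_real. Qed.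

Lemma fracK y : y = frac y + (Num.floor y)%:~R.
Proof. by rewrite subrK. Qed.

Lemma sin_pi_neq0 y : y \isn't a Num.int -> sin (pi * y) != 0.
Proof.
move=> yint; have f0 : 0 < frac y.
  rewrite lt_neqAle frac_ge0 andbT eq_sym subr_eq0.
  by apply: contraNneq yint => ->; apply: intr_int.
rewrite -normr_gt0 (fracK y) mulrDr norm_sinDpi_int.
by rewrite normr_gt0 gt_eqF // sin_gt0_pi // mulr_gt0 ?pi_gt0 //= gtr_pMr ?pi_gt0 // frac_lt1.
Qed.

(** Multiplication by 2 sin(pi y) turns each cosine into a difference of consecutive sines. *)
Lemma sum_cos1_telescope y p (N : nat) :
  sin (pi * y) * 2 * (\sum_(n < N) cos1 (n%:R * y + p)) =
  sin (pi * ((N%:R *+ 2 - 1) * y + p *+ 2)) - sin (pi * (p *+ 2 - y)).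
Proof.
elim: N => [|N IH].
  by rewrite big_ord0 mulr0; apply/esym/eqP; rewrite subr_eq0; apply/eqP; congr (sin (pi * _)); lra.
rewrite big_ord_recr /= mulrDr IH /cos1.
set u := pi *+ 2 * (N%:R * y + p).
have -> : pi * ((N%:R *+ 2 - 1) * y + p *+ 2) = u - pi * y by rewrite /u; lra.
have -> : pi * ((N.+1%:R *+ 2 - 1) * y + p *+ 2) = u + pi * y by rewrite /u -natr1; lra.
rewrite (sinD u (pi * y)) (sinB u (pi * y)); lra.
Qed.

Lemma sum_cos1_bound y p (N : nat) : sin (pi * y) != 0 ->
  `|\sum_(n < N) cos1 (n%:R * y + p)| <= `|sin (pi * y)|^-1.
Proof.
move=> s0; rewrite -[X in _ <= X]mul1r ler_pdivlMr ?normr_gt0 //.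
rewrite -normrM mulrC.
have := sum_cos1_telescope y p N.
set S := \sum_(n < N) _; set a := sin (_ * (_ + _)); set b := sin (_ * (_ - _)) => h.
have a1 : `|a| <= 1 by apply: sin_max.
have b1 : `|b| <= 1 by apply: sin_max.
have -> : sin (pi * y) * S = (a - b) / 2 by rewrite -h; lra.
move: a1 b1; rewrite !ler_norml => /andP[? ?] /andP[? ?]; apply/andP; split; lra.
Qed.

(** The two end sines of the telescoped sum differ by whole periods. This orthogonality relation is
    what makes the Fejer kernels sum to 1. *)
Lemma sum_cos1_period y p (N : nat) : y \isn't a Num.int -> N%:R * y \is a Num.int ->
  \sum_(n < N) cos1 (n%:R * y + p) = 0.
Proof.
move=> yint /intrP[m hm].
have := sum_cos1_telescope y p N.
have -> : pi * ((N%:R *+ 2 - 1) * y + p *+ 2) = pi * (p *+ 2 - y) + (pi *+ 2 * (N%:R * y)) by lra.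
have -> : sin (pi * (p *+ 2 - y) + pi *+ 2 * (N%:R * y)) = sin (pi * (p *+ 2 - y)).
  rewrite -!cosBpihalf.
  have E z : cos z = cos1 (z / (pi *+ 2)).
    by rewrite /cos1 mulrCA divff ?mulr1 // mulrn_eq0 /= gt_eqF ?pi_gt0.
  rewrite hm [LHS]E.
  have -> : (pi * (p *+ 2 - y) + pi *+ 2 * m%:~R - pi / 2) / (pi *+ 2) =
    (pi * (p *+ 2 - y) - pi / 2) / (pi *+ 2) + m%:~R.
    by rewrite addrAC [LHS]mulrDl [pi *+ 2 * _]mulrC mulfK // mulrn_eq0 /= gt_eqF ?pi_gt0.
  by rewrite cos1Dint -E.
rewrite subrr => /eqP; rewrite !mulf_eq0 (negPf (sin_pi_neq0 yint)) /= pnatr_eq0 /=.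
by move=> /eqP.
Qed.

Lemma cos1M (x y : R) : cos1 x * cos1 y = 2^-1 * cos1 (x + y) + 2^-1 * cos1 (x - y).
Proof. by rewrite /cos1 mulrDr mulrBr cosD cosB; lra. Qed.

End Trigonometry.

Section Means.
Variable R : realType.

(* The average runs over the indices 1, ..., N, as in [has_density]. *)
Definition has_mean (u : nat -> R) (c : R) :=
  (fun N : nat => (\sum_(n < N) u n.+1) / N%:R) @ \oo --> c.

Lemma has_mean_eq u v c : (forall n, u n = v n) -> has_mean u c -> has_mean v c.
Proof. by move=> /funext ->. Qed.

Lemma has_meanD u v c d : has_mean u c -> has_mean v d ->
  has_mean (fun n => u n + v n) (c + d).
Proof.
move=> hu hv; rewrite /has_mean.
under eq_fun do rewrite big_split /= mulrDl.
exact: cvgD.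
Qed.

Lemma has_meanZ a u c : has_mean u c -> has_mean (fun n => a * u n) (a * c).
Proof.
move=> hu; rewrite /has_mean.
under eq_fun do rewrite -mulr_sumr -mulrA.
by apply: cvgM => //; exact: cvg_cst.
Qed.

Arguments has_meanZ a [u c].

Lemma has_mean_cst c : has_mean (fun=> c) c.
Proof.
(* At N = 0 the quotient is 0, so the averages are constant only from N = 1 on. *)
rewrite /has_mean -cvg_shiftS /=.
apply: cvg_near_cst; near=> N.
rewrite sumr_const card_ord -[c *+ _]mulr_natr mulfK // pnatr_eq0.
Unshelve. all: by end_near. Qed.

Lemma has_mean0_bounded u B : (forall N : nat, `|\sum_(n < N) u n.+1| <= B) ->
  has_mean u 0.
Proof.
move=> hB; apply/cvgrPdist_le => e e0.
near=> N.
rewrite sub0r normrN normrM normfV normr_nat.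
have N0 : 0 < N%:R :> R by near: N; exact: nbhs_infty_gtr.
rewrite ler_pdivrMr //; apply: le_trans (hB N) _.
rewrite mulrC -ler_pdivrMr //; near: N; exact: nbhs_infty_ger.
Unshelve. all: by end_near. Qed.

(* [trig_poly f c]: f is a trigonometric polynomial of period 1 with constant
   coefficient c. *)
Inductive trig_poly : (R -> R) -> R -> Prop :=
| TrigCst c : trig_poly (fun=> c) c
| TrigCos m p of m != 0 : trig_poly (fun x => cos1 (m%:~R * x + p)) 0
| TrigAdd f g c d of trig_poly f c & trig_poly g d : trig_poly (fun x => f x + g x) (c + d)
| TrigScale a f c of trig_poly f c : trig_poly (fun x => a * f x) (a * c).

Lemma trig_poly_sum (I : Type) (r : seq I) (P : pred I) (f : I -> R -> R) (c : I -> R) :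
  (forall i, P i -> trig_poly (f i) (c i)) ->
  trig_poly (fun x => \sum_(i <- r | P i) f i x) (\sum_(i <- r | P i) c i).
Proof.
move=> h; elim: r => [|i r IH].
  by rewrite big_nil; under eq_fun do rewrite big_nil; constructor.
rewrite big_cons; under eq_fun do rewrite big_cons.
case: ifP => Pi; last exact: IH.
by constructor => //; apply: h.
Qed.

(** Only the constant coefficient of [f] contributes; every other term correlates [u] with a cosine
    of nonzero frequency, which is assumed to average out. *)
Lemma has_mean_trigM u M (t : R) (f : R -> R) c :
  trig_poly f c -> has_mean u M ->
  (forall m p, m != 0 -> has_mean (fun n => cos1 (n%:R * (m%:~R * t) + p) * u n) 0) ->
  has_mean (fun n => f (n%:R * t) * u n) (c * M).
Proof.
move=> tf hu hc; elim: tf => [{}c|m p m0|{}f g {}c d _ IHf _ IHg|a {}f {}c _ IHf].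
- exact: has_meanZ.
- by rewrite mul0r; apply: (has_mean_eq _ (hc m p m0)) => n; rewrite mulrCA.
- by rewrite mulrDl; apply: (has_mean_eq _ (has_meanD IHf IHg)) => n; rewrite mulrDl.
- by rewrite -mulrA; apply: (has_mean_eq _ (has_meanZ a IHf)) => n; rewrite mulrA.
Qed.

(** Multiplying a cosine of frequency y by one of frequency m t gives frequencies y + m t and y - m
    t, so the hypothesis has to cover all shifts of y by multiples of t. *)
Lemma has_mean0_trigM u (t y : R) (f : R -> R) c :
  trig_poly f c ->
  (forall m p, has_mean (fun n => cos1 (n%:R * (y + m%:~R * t) + p) * u n) 0) ->
  forall p, has_mean (fun n => cos1 (n%:R * y + p) * (f (n%:R * t) * u n)) 0.
Proof.
move=> tf hu; elim: tf => [{}c|m q m0|{}f g {}c d _ IHf _ IHg|a {}f {}c _ IHf] p.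
- have := has_meanZ c (hu 0 p); rewrite mulr0 mul0r addr0.
  by apply: has_mean_eq => n; rewrite mulrCA.
- have := has_meanD (has_meanZ 2^-1 (hu m (p + q))) (has_meanZ 2^-1 (hu (- m) (p - q))).
  rewrite !mulr0 addr0; apply: has_mean_eq => n; rewrite [RHS]mulrA cos1M mulrDl -!mulrA.
  by congr (_ * (cos1 _ * _) + _ * (cos1 _ * _)); rewrite ?mulrNz; lra.
- have := has_meanD (IHf p) (IHg p); rewrite addr0.
  by apply: has_mean_eq => n; rewrite mulrDl mulrDr.
- have := has_meanZ a (IHf p); rewrite mulr0.
  by apply: has_mean_eq => n; rewrite -[a * _ * _]mulrA [RHS]mulrCA.
Qed.

Variables (T : eqType) (t : T -> R) (f : T -> R -> R) (c : T -> R).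
Hypothesis tf : forall i, trig_poly (f i) (c i).

Definition int_comb (s : seq T) (h : T -> int) : R := \sum_(i <- s) (h i)%:~R * t i.

(** Each factor of the product is absorbed into a shift of y; when none is left, a single cosine sum
    of frequency y remains, bounded because y is not an integer. *)
Lemma has_mean0_prod (s : seq T) (y : R) : uniq s ->
  (forall h, y + int_comb s h \isn't a Num.int) ->
  forall p, has_mean (fun n => cos1 (n%:R * y + p) * \prod_(i <- s) f i (n%:R * t i)) 0.
Proof.
elim: s y => [|i s IH] y.
  move=> _ /(_ (fun=> 0)); rewrite /int_comb big_nil addr0 => /sin_pi_neq0 s0 p.
  apply: (@has_mean0_bounded _ `|sin (pi * y)|^-1) => N.
  under eq_bigr do rewrite big_nil mulr1 -natr1 mulrDl mul1r -addrA.
  exact: sum_cos1_bound.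
move=> /= /andP[si us] hy p.
apply: (@has_mean_eq (fun n => cos1 (n%:R * y + p) *
  (f i (n%:R * t i) * \prod_(j <- s) f j (n%:R * t j)))).
  by move=> n; rewrite big_cons.
apply: has_mean0_trigM; first exact: tf.
move=> m q; apply: IH => // h.
have := hy (fun j => if j == i then m else h j).
rewrite /int_comb big_cons eqxx addrA; congr (~~ (_ + _ \is a Num.int)).
apply: eq_big_seq => j js; case: eqP => // ji; by rewrite -ji js in si.
Qed.

(** Weyl's criterion for products. The constant term of the first factor leaves the product over the
    rest; its other terms bring in a frequency m t_i with m nonzero, which independence keeps away
    from the integers under every shift. *)
Lemma has_mean_prod (s : seq T) : uniq s ->
  (forall h, int_comb s h \is a Num.int -> forall i, i \in s -> h i = 0) ->
  has_mean (fun n => \prod_(i <- s) f i (n%:R * t i)) (\prod_(i <- s) c i).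
Proof.
elim: s => [|i s IH].
  by move=> _ _; rewrite big_nil; apply: (has_mean_eq _ (@has_mean_cst 1)) => n; rewrite big_nil.
move=> /= /andP[si us] hs.
have comb_cons m h : int_comb (i :: s) (fun j => if j == i then m else h j) =
    m%:~R * t i + int_comb s h.
  rewrite /int_comb big_cons eqxx; congr (_ + _).
  by apply: eq_big_seq => j js; case: eqP => // ji; rewrite -ji js in si.
rewrite big_cons; apply: (@has_mean_eq (fun n => f i (n%:R * t i) *
  \prod_(j <- s) f j (n%:R * t j))); first by move=> n; rewrite big_cons.
apply: has_mean_trigM => //.
  apply: IH => // h hh j js.
  have := hs (fun j => if j == i then 0 else h j).
  rewrite comb_cons mul0r add0r => /(_ hh j); rewrite inE js orbT => /(_ isT).
  by case: eqP => // ji; rewrite -ji js in si.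
move=> m p m0; apply: has_mean0_prod => // h; apply/negP => hh.
have := hs (fun j => if j == i then m else h j); rewrite comb_cons.
by move=> /(_ hh i (mem_head _ _)); rewrite eqxx => m0'; rewrite m0' in m0.
Qed.

End Means.

(** * Fejer kernels *)

Section Fejer.
Variable R : realType.

(* F_H(x - j/H) / H for the Fejer kernel F_H(y) = |sum_(a < H) e(a y)|^2 / H. As
   F_H has degree less than H, these functions sum to 1 over j < H. *)
Definition fejer (H j : nat) (x : R) : R :=
  H%:R ^- 2 * \sum_(a < H) \sum_(b < H) cos1 ((a%:R - b%:R) * (x - j%:R / H%:R)).

(** This is the squared modulus of the exponential sum: the phase -1/4 turns the cosines of the
    second square into sines. *)
Lemma fejer_double_sum (H : nat) (y : R) :
  \sum_(a < H) \sum_(b < H) cos1 ((a%:R - b%:R) * y) =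
  (\sum_(a < H) cos1 (a%:R * y + 0)) ^+ 2 + (\sum_(a < H) cos1 (a%:R * y + - 4^-1)) ^+ 2.
Proof.
rewrite !expr2 !big_distrlr -big_split; apply: eq_bigr => a _.
rewrite -big_split; apply: eq_bigr => b _ /=.
have E (c : nat) : cos1 (c%:R * y + - 4^-1) = sin (pi *+ 2 * (c%:R * y)).
  by rewrite -cosBpihalf /cos1; congr cos; lra.
by rewrite !E /cos1 !addr0 mulrBl mulrBr cosB.
Qed.

Lemma fejer_ge0 H j x : 0 <= fejer H j x.
Proof.
rewrite /fejer fejer_double_sum mulr_ge0 ?addr_ge0 ?sqr_ge0 // invr_ge0 exprn_ge0.
Qed.

Lemma fejer_le H j x (e : R) : 0 < e -> e <= `|sin (pi * (x - j%:R / H%:R))| ->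
  fejer H j x <= H%:R ^- 2 * (2 * e ^- 2).
Proof.
move=> e0 es; rewrite /fejer fejer_double_sum ler_wpM2l ?invr_ge0 ?exprn_ge0 //.
set y := x - _ in es *.
have s0 : sin (pi * y) != 0 by rewrite -normr_gt0 (lt_le_trans e0).
have B p : (\sum_(a < H) cos1 (a%:R * y + p)) ^+ 2 <= e ^- 2.
  rewrite -real_normK ?num_real // -exprVn lerXn2r ?nnegrE ?invr_ge0 ?(ltW e0) //.
  apply: le_trans (sum_cos1_bound p H s0) _.
  by rewrite lef_pV2 // posrE normr_gt0.
by rewrite mulr2n mulrDl mul1r lerD.
Qed.

(** After summing over j only the diagonal a = b survives: otherwise 0 < |a - b| < H, and the
    cosines run over whole periods with the non-integral frequency (b - a)/H. *)
Lemma sum_fejer H x : (0 < H)%N -> \sum_(j < H) fejer H j x = 1.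
Proof.
move=> H0; have H0' : H%:R != 0 :> R by rewrite pnatr_eq0 -lt0n.
rewrite -mulr_sumr exchange_big /=.
rewrite (eq_bigr (fun=> H%:R)); last first.
  move=> a _; rewrite exchange_big /= (bigD1 a) //=.
  rewrite (eq_bigr (fun=> 1)) ?sumr_const ?card_ord; last first.
    by move=> j _; rewrite subrr mul0r /cos1 mulr0 cos0.
  rewrite big1 ?addr0 // => b ba.
  under eq_bigr => j _.
    have -> : (a%:R - b%:R) * (x - j%:R / H%:R) =
      j%:R * ((b%:R - a%:R) / H%:R) + (a%:R - b%:R) * x :> R by lra.
    over.
  apply: sum_cos1_period; last first.
    by rewrite mulrCA divff // mulr1 rpredB // intr_nat ?natr_nat.
  apply/negP => /intrP [m hm].
  have {}hm : b%:Z - a%:Z = m * H%:Z.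
    apply: (@intr_inj R); rewrite intrB intrM -!pmulrn -hm.
    by rewrite mulfVK.
  have := ltn_ord a; have := ltn_ord b; move: ba; rewrite -val_eqE /=.
  case: m hm => [[|m]|m]; rewrite ?NegzE.
  - by move=> h /eqP; lia.
  - by move=> h _ bH aH; have := leq_pmull H (isT : 0 < m.+1)%N; lia.
  - by move=> h _ bH aH; have := leq_pmull H (isT : 0 < m.+1)%N; lia.
rewrite sumr_const card_ord -[H%:R *+ H]mulr_natr -expr2 mulVf //.
by rewrite expf_neq0.
Qed.

Lemma trig_poly_fejer H j : (0 < H)%N -> trig_poly (fejer H j) H%:R^-1.
Proof.
move=> H0; have H0' : H%:R != 0 :> R by rewrite pnatr_eq0 -lt0n.
have -> : H%:R^-1 = H%:R ^- 2 * \sum_(a < H) \sum_(b < H) (a == b)%:R :> R.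
  rewrite (eq_bigr (fun=> 1)); last first.
    move=> a _; rewrite (bigD1 a) //= eqxx big1 ?addr0 // => b.
    by rewrite eq_sym => /negPf ->.
  by rewrite sumr_const card_ord expr2 invfM -mulrA mulVf ?mulr1.
apply: TrigScale; apply: trig_poly_sum => a _; apply: trig_poly_sum => b _.
have [->|ab] := eqVneq a b.
  under eq_fun do rewrite subrr mul0r /cos1 mulr0 cos0.
  exact: TrigCst.
have -> : (fun x => cos1 ((a%:R - b%:R) * (x - j%:R / H%:R))) =
  (fun x => cos1 ((a%:Z - b%:Z)%:~R * x + (b%:R - a%:R) * (j%:R / H%:R)) : R).
  by apply/funext => x; congr cos1; rewrite intrB -!pmulrn; lra.
by apply: TrigCos; rewrite subr_eq0; apply: contraNneq ab => -[] /val_inj ->.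
Qed.

Definition in_shrunk (H : nat) (a b : R) (j : 'I_H) := (a <= j%:R / H%:R) && (j%:R / H%:R <= b).

(** A smoothed indicator of [a, b]: the part of the partition of unity whose nodes j/H lie in the
    interval. *)
Definition fejer_bump (H : nat) (a b x : R) : R := \sum_(j < H | in_shrunk a b j) fejer H j x.

Definition fejer_bump_mean (H : nat) (a b : R) : R := \sum_(j < H | in_shrunk a b j) H%:R^-1.

Lemma trig_poly_fejer_bump H a b : (0 < H)%N -> trig_poly (fejer_bump H a b) (fejer_bump_mean H a b).
Proof. by move=> H0; apply: trig_poly_sum => j _; apply: trig_poly_fejer. Qed.

Lemma fejer_bump_ge0 H a b x : 0 <= fejer_bump H a b x.
Proof. by apply: sumr_ge0 => j _; apply: fejer_ge0. Qed.

Lemma fejer_bump_le1 H a b x : (0 < H)%N -> fejer_bump H a b x <= 1.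
Proof.
move=> H0; rewrite -(sum_fejer x H0) /fejer_bump [X in X <= _]big_mkcond.
by apply: ler_sum => j _; case: ifP => // _; apply: fejer_ge0.
Qed.

Lemma fejer_bump_mean_ge0 H a b : 0 <= fejer_bump_mean H a b.
Proof. by apply: sumr_ge0 => j _; rewrite invr_ge0. Qed.

Lemma fejer_bump_mean_le1 H a b : fejer_bump_mean H a b <= 1.
Proof.
have [->|H0] := posnP H; first by rewrite /fejer_bump_mean big_ord0.
have H0' : H%:R != 0 :> R by rewrite pnatr_eq0 -lt0n.
rewrite /fejer_bump_mean big_mkcond /=; apply: (@le_trans _ _ (\sum_(j < H) H%:R^-1)).
  by apply: ler_sum => j _; case: ifP => // _; rewrite invr_ge0.
by rewrite sumr_const card_ord -[H%:R^-1 *+ _]mulr_natr mulVf.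
Qed.

(** The nodes with floor(aH) < j <= floor(bH) lie in [a, b]; there are at least (b - a)H - 1 of
    them, and b < 1 keeps j below H. *)
Lemma fejer_bump_mean_ge H a b : (0 < H)%N -> 0 <= a -> b < 1 ->
  b - a - H%:R^-1 <= fejer_bump_mean H a b.
Proof.
move=> H0 a0 b1; have H0' : 0 < H%:R :> R by rewrite ltr0n.
have [ba|ab] := ltP b a.
  apply: le_trans (fejer_bump_mean_ge0 _ _ _).
  have : 0 <= H%:R^-1 :> R by rewrite invr_ge0.
  by move=> h; lra.
have b0 : 0 <= b by apply: le_trans ab.
have /andP[p1 p2] := @truncn_itv R (a * H%:R) (mulr_ge0 a0 (ltW H0')).
have /andP[q1 q2] := @truncn_itv R (b * H%:R) (mulr_ge0 b0 (ltW H0')).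
set p := Num.truncn _ in p1 p2; set q := Num.truncn _ in q1 q2.
have qH : (q < H)%N.
  by rewrite -(ltr_nat R); apply: le_lt_trans q1 _; rewrite gtr_pMl.
have pq : (p <= q)%N by apply: le_truncn; rewrite ler_pM2r.
have -> : fejer_bump_mean H a b =
    \sum_(0 <= j < H | (a <= j%:R / H%:R) && (j%:R / H%:R <= b)) H%:R^-1.
  by rewrite big_mkord.
apply: (@le_trans _ _ (\sum_(p.+1 <= j < q.+1) H%:R^-1)).
  rewrite sumr_const_nat subSS -[H%:R^-1 *+ _]mulr_natl.
  rewrite ler_pdivlMr // !mulrBl mulVf ?gt_eqF //.
  by rewrite natrB //; move: p1 q2; rewrite -natr1; lra.
rewrite [X in _ <= X](big_cat_nat _ (n := p.+1)) //=; last first.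
  by apply: leq_trans qH; rewrite ltnS.
rewrite [X in _ <= _ + X](big_cat_nat _ (n := q.+1)) //=.
rewrite [X in _ <= _ + (X + _)]big_nat_cond.
rewrite [X in _ <= _ + (X + _)](eq_bigl (fun j => (p.+1 <= j < q.+1)%N)); last first.
  move=> j; case: (ltnP p j) => //= pj; rewrite ltnS; case: (leqP j q) => //= jq.
  apply/andP; split.
    rewrite ler_pdivlMr //; apply: le_trans (ltW p2) _.
    by rewrite ler_nat.
  by rewrite ler_pdivrMr //; apply: le_trans q1; rewrite ler_nat.
rewrite -big_nat addrCA lerDl addr_ge0 // sumr_ge0 // => *; by rewrite invr_ge0.
Qed.

(** Keeping y at distance d from both 0 and 1 gives |x - y| <= 1 - d, so x - y is at distance at
    least d from every integer, not only from 0. The sine is increasing on the first quarter period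
    and symmetric about pi/2. *)
Lemma sin_far (d x y : R) : 0 < d -> d <= y <= 1 - d -> 0 <= x < 1 -> d <= `|x - y| ->
  sin (pi * d) <= `|sin (pi * (x - y))|.
Proof.
move=> d0 /andP[y0 y1] /andP[x0 x1] xy.
have xy1 : `|x - y| <= 1 - d.
  by rewrite ler_norml; apply/andP; split; lra.
have pi0 := pi_gt0 R.
have mono (u v : R) : 0 <= u -> u <= v -> v <= 2^-1 -> sin (pi * u) <= sin (pi * v).
  move=> u0 uv v2; rewrite le_eqVlt; have [->|ne] := eqVneq u v; first by rewrite eqxx.
  apply/orP; right; rewrite ltr_sin.
  - by rewrite ltr_pM2l // lt_neqAle ne.
  - rewrite in_itv /=; apply/andP; split; nra.
  - rewrite in_itv /=; apply/andP; split; nra.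
have E : `|sin (pi * (x - y))| = sin (pi * `|x - y|).
  have [h|h] := ger0P (x - y).
    rewrite ger0_norm // sin_ge0_pi //.
    by apply/andP; split; [rewrite mulr_ge0 // ltW|rewrite ger_pMr //; lra].
  rewrite -normrN -sinN -mulrN ger0_norm // sin_ge0_pi //.
  by apply/andP; split; [rewrite mulr_ge0 // ?ltW //; lra|rewrite ger_pMr //; lra].
rewrite E; have [h|h] := leP `|x - y| 2^-1; first by apply: mono => //; apply: ltW.
have -> : sin (pi * `|x - y|) = sin (pi * (1 - `|x - y|)).
  rewrite mulrBr mulr1 sinB sinpi cospi; lra.
by apply: mono; lra.
Qed.

End Fejer.

(** * Lower densities of boxes *)

Section Box.
Variable R : realType.

Definition in_box (a b x : R) := (a <= frac x) && (frac x < b).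

(** The nodes lie in the interval shrunk by d, hence far from x modulo 1; each of the at most H
    kernels is then of order 1/H^2. *)
Lemma fejer_bump_out (H : nat) (a b d x : R) : (0 < H)%N -> 0 < d -> d < 1 -> 0 <= a -> b <= 1 ->
  ~~ in_box a b x -> fejer_bump H (a + d) (b - d) x <= 2 * sin (pi * d) ^- 2 / H%:R.
Proof.
move=> H0 d0 d1 a0 b1 out; have H0' : 0 < H%:R :> R by rewrite ltr0n.
have pi0 := pi_gt0 R.
have s0 : 0 < sin (pi * d) by rewrite sin_gt0_pi // mulr_gt0 //= gtr_pMr.
apply: (@le_trans _ _ (\sum_(j < H) H%:R ^- 2 * (2 * sin (pi * d) ^- 2))); last first.
  rewrite sumr_const card_ord -[X in X <= _]mulr_natl.
  rewrite le_eqVlt; apply/orP; left; apply/eqP.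
  by rewrite (expr2 H%:R) invfM !mulrA divff ?gt_eqF // mul1r; lra.
rewrite /fejer_bump big_mkcond; apply: ler_sum => j _; case: ifP; last first.
  by move=> _; rewrite !mulr_ge0 ?invr_ge0 ?exprn_ge0 // ltW.
move=> /andP[j1 j2]; apply: fejer_le => //.
rewrite {1}(fracK x) addrAC mulrDr norm_sinDpi_int.
apply: sin_far => //.
- by apply/andP; split; lra.
- by rewrite frac_ge0 frac_lt1.
move: out; rewrite /in_box negb_and -ltNge -leNgt => /orP[h|h].
  by rewrite -normrN opprB ger0_norm; lra.
by rewrite ger0_norm; lra.
Qed.

Lemma prod_ge_sub (T : Type) (s : seq T) (v c : T -> R) (h : R) : 0 <= h ->
  (forall i, 0 <= v i <= 1) -> (forall i, 0 <= c i <= 1) -> (forall i, v i - h <= c i) ->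
  \prod_(i <- s) v i - (size s)%:R * h <= \prod_(i <- s) c i.
Proof.
move=> h0 hv hc hvc; elim: s => [|i s IH]; first by rewrite !big_nil mul0r subr0.
rewrite !big_cons /= -natr1.
have V0 : 0 <= \prod_(j <- s) v j <= 1.
  by apply/andP; split; [apply: prodr_ge0|apply: prodr_ile1] => j _ //; have /andP[] := hv j.
move: V0 IH; set V := \prod_(j <- s) v j; set C := \prod_(j <- s) c j => /andP[V0 V1] IH.
have /andP[v0 v1] := hv i; have /andP[c0 c1] := hc i; have vc := hvc i.
have n0 : 0 <= (size s)%:R :> R by [].
(* The difference of the two sides is exactly the sum of the four nonnegative products that
   follow. *)
have : 0 <= c i * (C - V + (size s)%:R * h) by rewrite mulr_ge0 //; lra.
have : 0 <= (c i - v i + h) * V by rewrite mulr_ge0 //; lra.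
have : 0 <= (1 - c i) * ((size s)%:R * h) by rewrite !mulr_ge0 //; lra.
have : 0 <= h * (1 - V) by rewrite mulr_ge0 //; lra.
lra.
Qed.

(* Smoothing slightly shrunk intervals by Fejer kernels gives trigonometric
   polynomials whose product exceeds the indicator of the box by at most a small
   constant. *)
Theorem box_lower_density (T : eqType) (t a b : T -> R) (s : seq T) (e : R) :
  uniq s -> (forall h, int_comb t s h \is a Num.int -> forall i, i \in s -> h i = 0) ->
  (forall i, [/\ 0 <= a i, a i <= b i & b i <= 1]) -> 0 < e ->
  \forall N \near \oo, (\prod_(i <- s) (b i - a i) - e) * N%:R <=
    \sum_(n < N) (all (fun i => in_box (a i) (b i) (n.+1%:R * t i)) s)%:R.
Proof.
move=> us ind ab e0; set S := size s.
(* Error budget: shrinking costs 2d and discretising 1/H <= d per factor, at most 3e/8 in all; the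
   kernels outside the box and the convergence of the mean cost e/4 each. The two summands in the
   choice of [H] below give 1/H <= d and K/H <= e/4. *)
pose d := Num.min (e / (8 * S.+1%:R)) 2^-1.
have S0 : 0 < S.+1%:R :> R by [].
have d0 : 0 < d by rewrite lt_min divr_gt0 ?mulr_gt0 //= invr_gt0.
have d1 : d < 1 by rewrite gt_min; apply/orP; right; lra.
have dS : S%:R * d <= e / 8.
  apply: (@le_trans _ _ (S.+1%:R * d)); first by rewrite ler_wpM2r ?ler_nat // ltW.
  apply: (@le_trans _ _ (S.+1%:R * (e / (8 * S.+1%:R)))).
    by rewrite ler_pM2l // ge_min lexx.
  rewrite le_eqVlt; apply/orP; left; apply/eqP.
  by rewrite mulrC invfM mulrA mulfVK // gt_eqF.
have pi0 := pi_gt0 R.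
have s0 : 0 < sin (pi * d) by rewrite sin_gt0_pi // mulr_gt0 //= gtr_pMr.
pose K := 2 * sin (pi * d) ^- 2.
have K0 : 0 < K by rewrite mulr_gt0 // invr_gt0 exprn_gt0.
pose H := (Num.truncn (d^-1 + 4 * K / e)).+1.
have HK : d^-1 + 4 * K / e < H%:R by rewrite real_truncnS_gt ?num_real.
have H0 : 0 < H%:R :> R by [].
have Hd : H%:R^-1 <= d.
  rewrite -[d]invrK lef_pV2 ?posrE ?invr_gt0 //; apply: ltW; apply: le_lt_trans HK.
  by rewrite lerDl; apply: ltW; apply: divr_gt0 => //; exact: mulr_gt0.
have KH : K / H%:R <= e / 4.
  have : 4 * K / e < H%:R by apply: lt_trans HK; rewrite ltrDr invr_gt0.
  by rewrite ltr_pdivrMr // ler_pdivrMr //; lra.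
pose f i := fejer_bump H (a i + d) (b i - d); pose c i := fejer_bump_mean H (a i + d) (b i - d).
have mean : has_mean (fun n => \prod_(i <- s) f i (n%:R * t i)) (\prod_(i <- s) c i).
  by apply: has_mean_prod => // i; apply: trig_poly_fejer_bump.
have cv : \prod_(i <- s) (b i - a i) - S%:R * (3 * d) <= \prod_(i <- s) c i.
  apply: prod_ge_sub => [|i|i|i].
  - by rewrite mulr_ge0 // ltW.
  - by have [? ? ?] := ab i; apply/andP; split; lra.
  - by rewrite fejer_bump_mean_ge0 fejer_bump_mean_le1.
  - have [? ? ?] := ab i.
    apply: le_trans (fejer_bump_mean_ge _ _ _); rewrite //; lra.
move/cvgrPdist_le : mean => /(_ (e / 4)) [|N0 _ HN]; first by rewrite divr_gt0.
exists N0.+1 => // N /= NN0.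
have NR : 0 < N%:R :> R by rewrite ltr0n (leq_trans _ NN0).
have := HN N (ltnW NN0); rewrite ler_norml => /andP[_]; rewrite lerBlDr -lerBlDl.
rewrite ler_pdivlMr // => hm.
have pt n : \prod_(i <- s) f i (n%:R * t i) - e / 4 <=
    (all (fun i => in_box (a i) (b i) (n%:R * t i)) s)%:R.
  have f01 i x : 0 <= f i x <= 1 by rewrite fejer_bump_ge0 fejer_bump_le1.
  case: allP => [_|/allP].
    apply: (@le_trans _ _ 1); last by [].
    have : \prod_(i <- s) f i (n%:R * t i) <= 1 by apply: prodr_ile1 => i _; apply: f01.
    by move=> p1; lra.
  rewrite -has_predC => /hasP[i is_ /= out].
  rewrite subr_le0 (bigD1_seq i) //=; apply: le_trans KH.
  apply: (@le_trans _ _ (f i (n%:R * t i))).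
    rewrite ler_piMr //; first by have /andP[] := f01 i (n%:R * t i).
    by apply: prodr_ile1 => j _; apply: f01.
  by have [? ? ?] := ab i; apply: fejer_bump_out.
apply: (@le_trans _ _ (\sum_(n < N) (\prod_(i <- s) f i (n.+1%:R * t i) - e / 4))).
  rewrite sumrB sumr_const card_ord -[X in _ <= _ - X]mulr_natr.
  rewrite lerBrDr -mulrDl; apply: le_trans hm.
  rewrite ler_pM2r //; lra.
by apply: ler_sum => n _; apply: pt.
Qed.

End Box.

(** * The set Lambda *)

Lemma logn_big_prod (I : Type) (s : seq I) (F : I -> nat) (p : nat) :
  (forall i, 0 < F i)%N -> logn p (\prod_(i <- s) F i)%N = (\sum_(i <- s) logn p (F i))%N.
Proof.
move=> F0; elim: s => [|i s IH]; first by rewrite !big_nil logn1.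
by rewrite !big_cons lognM ?IH // prodn_gt0.
Qed.

Lemma logn_prod_primes (s : seq nat) (f : nat -> nat) (q : nat) :
  uniq s -> all prime s ->
  logn q (\prod_(p <- s) p ^ f p)%N = (if q \in s then f q else 0)%N.
Proof.
elim: s => [|p s IH] /=; first by rewrite big_nil logn1.
move=> /andP[ps us] /andP[pp sp].
have pos : (0 < \prod_(p <- s) p ^ f p)%N.
  rewrite big_seq prodn_cond_gt0 // => r rs.
  by rewrite expn_gt0 prime_gt0 // (allP sp).
rewrite big_cons lognM ?expn_gt0 ?(prime_gt0 pp) // lognX logn_prime // IH // inE.
by case: (eqVneq q p) => [->|_]; rewrite ?muln0 // (negPf ps) muln1 addn0.
Qed.

Lemma sum_nat_delta (k r : nat) (F : nat -> nat) :
  (\sum_(1 <= i < k) (r == i) * F i = if (1 <= r < k) then F r else 0)%N.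
Proof.
case: ifP => hr; last first.
  rewrite big_nat big1 // => i hi; case: eqP => // ri; by rewrite ri hi in hr.
rewrite (bigD1_seq r) ?iota_uniq ?mem_index_iota //= eqxx mul1n big1 ?addn0 //.
by move=> i /negPf; rewrite eq_sym => ->.
Qed.

(** The values 0 and k + 1, ..., 2k - 1 represent each residue modulo k once, so a reduced number is
    determined by its class modulo [k]th powers. *)
Definition reduced (k n : nat) := forall p, (logn p n == 0) || (k < logn p n < k.*2)%N.

Lemma reduced1 k : reduced k 1.
Proof. by move=> p; rewrite logn1. Qed.

Lemma reduced_exponent_mod_inj (k a b : nat) :
  (a == 0) || (k < a < k.*2)%N -> (b == 0) || (k < b < k.*2)%N ->
  (a %% k = b %% k)%N -> a = b.
Proof.
have red c : (c == 0%N) || (k < c < k.*2)%N -> (c %% k = if c == 0 then 0 else c - k)%N.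
  case: eqP => [-> _|_ /= /andP[c1 c2]]; first by rewrite mod0n.
  rewrite -[in LHS](subnK (ltnW c1)) modnDr modn_small //.
  by rewrite ltn_subLR ?(ltnW c1) // addnn.
move=> ha hb; rewrite (red _ ha) (red _ hb); move: ha hb; clear red.
case: (eqVneq a 0%N) => [->|_]; case: (eqVneq b 0%N) => [->|_] //=; lia.
Qed.

Lemma reduced_eq (k m n u v : nat) : (0 < k)%N -> (0 < m)%N -> (0 < n)%N ->
  (0 < u)%N -> (0 < v)%N ->
  reduced k m -> reduced k n -> (v ^ k * m = u ^ k * n)%N -> m = n.
Proof.
move=> k0 m0 n0 u0 v0 rm rn E; apply: eqn_from_log => // p.
apply: (reduced_exponent_mod_inj (rm p) (rn p)).
have /(congr1 (modn^~ k)) := congr1 (logn p) E.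
by rewrite !lognM ?expn_gt0 ?u0 ?v0 // !lognX !(mulnC k) !modnMDl.
Qed.

Section Values.
Variables (k : nat) (b : nat -> nat).
Hypotheses (b0 : forall i, (1 <= i < k)%N -> (0 < b i)%N)
  (b2 : (2 <= \prod_(1 <= i < k) b i)%N)
  (sqf : squarefree (\prod_(1 <= i < k) b i)).

(** Nothing is known about [b] outside the range, where it may vanish; the value 1 there makes
    positivity unconditional. *)
Let b' i := if (1 <= i < k)%N then b i else 1%N.

Let b'0 i : (0 < b' i)%N.
Proof. by rewrite /b'; case: ifP => // /b0. Qed.

Let prod_b' (F : nat -> nat -> nat) :
  (\prod_(1 <= i < k) F (b i) i = \prod_(1 <= i < k) F (b' i) i)%N.
Proof. by apply: eq_big_nat => i hi; rewrite /b' hi. Qed.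

Lemma lambda_val_gt0 : (0 < \prod_(1 <= i < k) b i ^ (k + i))%N.
Proof.
rewrite (prod_b' (fun x i => x ^ (k + i))%N) prodn_gt0 // => i.
by rewrite expn_gt0 b'0.
Qed.

(** Some [b i] is at least 2, and its exponent k + i exceeds k. *)
Lemma lambda_val_gt : (2 ^ k < \prod_(1 <= i < k) b i ^ (k + i))%N.
Proof.
have [i hi bi] : exists2 i, (1 <= i < k)%N & (1 < b i)%N.
  apply: contrapT => no; move: b2; rewrite big_nat big1 // => i hi.
  apply/eqP; rewrite eqn_leq b0 // andbT leqNgt; apply/negP => bi.
  by apply: no; exists i.
apply: (@leq_trans (b i ^ (k + i))).
  apply: (@leq_trans (2 ^ (k + i))); last by rewrite leq_exp2r //; lia.
  by rewrite ltn_exp2l //; lia.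
apply: dvdn_leq; first exact: lambda_val_gt0.
by rewrite (bigD1_seq i) ?iota_uniq ?mem_index_iota //= dvdn_mulr.
Qed.

Lemma lambda_val_reduced : reduced k (\prod_(1 <= i < k) b i ^ (k + i))%N.
Proof.
move=> p; have [pp|pp] := boolP (prime p); last by rewrite lognE (negPf pp).
(* Squarefreeness: p divides at most one of the b_i, and only to the first power. *)
have le1 : (\sum_(1 <= i < k) logn p (b' i) <= 1)%N.
  rewrite -logn_big_prod // -(prod_b' (fun x _ => x)) leqNgt -pfactor_dvdn //.
    by rewrite expnS expn1; apply: sqf.
  by apply: ltnW.
rewrite (prod_b' (fun x i => x ^ (k + i))%N) logn_big_prod; last first.
  by move=> i; rewrite expn_gt0 b'0.
under eq_bigr do rewrite lognX.
have [/allP z|] := boolP (all (fun i => logn p (b' i) == 0)%N (index_iota 1 k)).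
  by rewrite big_seq big1 // => i /z /eqP ->; rewrite muln0.
rewrite -has_predC => /hasP[i ii /= ei].
move: le1; rewrite (bigD1_seq i) ?iota_uniq //= => le1.
have e1 : logn p (b' i) = 1%N by lia.
have : (\sum_(j <- index_iota 1 k | j != i) logn p (b' j) == 0)%N by lia.
rewrite sum_nat_seq_eq0 => /allP z.
rewrite (bigD1_seq i) ?iota_uniq //= e1 muln1.
rewrite big_seq_cond big1 ?addn0; last first.
  by move=> j /andP[/z /implyP h /h /eqP ->]; rewrite muln0.
by move: ii; rewrite mem_index_iota; lia.
Qed.

End Values.

Section LambdaFacts.
Variables (R : realType) (k : nat).
Hypothesis k2 : (2 <= k)%N.

Let k0 : (0 < k)%N. Proof. exact: ltnW. Qed.
Let kR : k%:R != 0 :> R. Proof. by rewrite pnatr_eq0 -lt0n. Qed.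

Lemma powR_invX (x : R) : 0 <= x -> (x `^ k%:R^-1) ^+ k = x.
Proof. by move=> x0; rewrite -powR_mulrn ?powR_ge0 // -powRrM mulVf // powRr1. Qed.

(** The arithmetic shared by the elements of Lambda and the number 1, which can thus be compared on
    the same footing. *)
Definition root_of (x : R) (N : nat) :=
  [/\ 0 < x, x ^+ k = N%:R, (0 < N)%N & reduced k N].

Lemma root_of1 : root_of 1 1.
Proof. by split=> //; [rewrite expr1n | exact: reduced1]. Qed.

Lemma Lambda_root_of (x : R) : @Lambda R k x -> exists2 N, root_of x N & (2 ^ k < N)%N.
Proof.
move=> [b [b0 [b2 [sq ->]]]].
exists (\prod_(1 <= i < k) b i ^ (k + i))%N; last exact: lambda_val_gt.
have p0 := lambda_val_gt0 b0; split=> //; last exact: lambda_val_reduced.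
  by rewrite powR_gt0 // ltr0n.
by rewrite powR_invX.
Qed.

Lemma Lambda_gt2 (x : R) : @Lambda R k x -> 2 < x.
Proof.
move=> /Lambda_root_of [N [x0 xk _ _] hN].
by rewrite -(ltr_pXn2r k0) ?nnegrE ?(ltW x0) // xk -natrX ltr_nat.
Qed.

Lemma is_rat_pos (x : R) : 0 < x -> is_rat x ->
  exists u v : nat, [/\ (0 < u)%N, (0 < v)%N & x * v%:R = u%:R].
Proof.
move=> x0 [q hq]; have q0 : 0 < q by rewrite -(ltr0q R) -hq.
exists `|numq q|%N, `|denq q|%N; split.
- by rewrite absz_gt0 numq_eq0 gt_eqF.
- by rewrite absz_gt0 denq_neq0.
rewrite hq /ratr.
have -> : `|denq q|%N%:R = (denq q)%:~R :> R.
  by rewrite pmulrn gez0_abs // denq_ge0.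
have -> : `|numq q|%N%:R = (numq q)%:~R :> R.
  by rewrite pmulrn gez0_abs // numq_ge0 ltW.
by rewrite divfK // intr_eq0 denq_neq0.
Qed.

Lemma root_of_ratio (x y : R) N M : root_of x N -> root_of y M -> is_rat (x / y) -> N = M.
Proof.
move=> [x0 xk N0 rN] [y0 yk M0 rM] /is_rat_pos[|u [v [u0 v0 E]]]; first by rewrite divr_gt0.
apply: (@reduced_eq k N M u v) => //.
apply/eqP; rewrite -(eqr_nat R) !natrM !natrX -xk -yk -!exprMn; apply/eqP; congr (_ ^+ _).
by rewrite -E mulrAC mulfVK ?gt_eqF // mulrC.
Qed.

(** An integral value m of the combination is a rational relation among the radicals 1 and 1/lambda,
    with coefficient -m at 1. *)
Lemma Lambda_inv_indep (s : seq R) : uniq s -> (forall x, x \in s -> @Lambda R k x) ->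
  forall h, int_comb (fun x : R => x^-1) s h \is a Num.int -> forall x, x \in s -> h x = 0.
Proof.
move=> us sL h /intrP[m hm] x xs.
pose q y : rat := if y == 1 :> R then - m%:~R else (h y^-1)%:~R.
have hN y : exists N, y \in 1 :: map GRing.inv s -> root_of y^-1 N.
  have [|] := boolP (y \in _); last by exists 0%N.
  rewrite inE => /predU1P[->|/mapP[z zs ->]].
    by exists 1%N => _; rewrite invr1; apply: root_of1.
  by have [N hN _] := Lambda_root_of (sL _ zs); exists N; rewrite invrK.
have sne1 y : y \in s -> y != 1.
  by move=> /sL /Lambda_gt2; apply: contraTneq => ->; rewrite -leNgt; lra.
have U : uniq (1 :: map GRing.inv s).
  rewrite /= map_inj_uniq ?us ?andbT; last exact: invr_inj.
  apply/negP => /mapP[z zs] /eqP; rewrite eq_sym invr_eq1 => /eqP z1.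
  by have := sne1 _ zs; rewrite z1 eqxx.
have xV : x^-1 \in 1 :: map GRing.inv s by rewrite inE map_f ?orbT.
have := @radicals_qindep R k (1 :: map GRing.inv s) q k0 U _ _ _ _ _ xV.
rewrite /q invr_eq1 (negPf (sne1 _ xs)) invrK => E.
apply/eqP; rewrite -(intr_eq0 rat); apply/eqP; apply: E.
- by move=> y ys; have [N /(_ ys) [+ _ _ _]] := hN y; rewrite invr_gt0.
- move=> y ys; have [N /(_ ys) [_ E _ _]] := hN y; exists (N%:R^-1).
  by rewrite fmorphV /= ratr_nat -E exprVn invrK.
- move=> y z ys zs yz.
  have [N /(_ ys) hy] := hN y; have [M /(_ zs) hz] := hN z => rat_yz.
  have NM : M = N by apply: (root_of_ratio hz hy); rewrite invrK mulrC.
  move: yz; rewrite -(inj_eq (@invr_inj _)) => /eqP; apply.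
  move: hy hz => [y0 yk _ _] [z0 zk _ _].
  by apply: (pexpIrn k0); rewrite ?nnegrE ?ltW // yk zk NM.
- rewrite big_cons eqxx rmorphN /= ratr_int mulr1 -hm /int_comb big_map.
  rewrite addrC; apply/eqP; rewrite subr_eq0; apply/eqP.
  by apply: eq_big_seq => y ys; rewrite invr_eq1 (negPf (sne1 _ ys)) invrK ratr_int.
Qed.

(** Each prime exponent of a^k N is a multiple of k plus 0 or something above k, whence k-fullness.
    A perfect [k]th power would force the reduced factor N to be 1, but N > 2^k. *)
Lemma S_of_Sk (j : nat) : S_of k (@Lambda R k) j -> Sk k j.
Proof.
move=> [a [a0 [l hl E]]].
have [N [l0 lk N0 rN] N2] := Lambda_root_of hl.
have {}E : (j = a ^ k * N)%N.
  by apply/eqP; rewrite -(eqr_nat R) E exprMn lk natrM natrX.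
have j0 : (0 < j)%N by rewrite E muln_gt0 expn_gt0 a0.
split; first split=> // p pp pj.
  rewrite pfactor_dvdn //; have : (0 < logn p j)%N by rewrite logn_gt0 mem_primes pp j0.
  rewrite E lognM ?expn_gt0 ?a0 // lognX; have := rN p.
  by case: (logn p a) => [|e]; rewrite ?muln0 ?mulnS; lia.
move=> [c hc].
have c0 : (0 < c)%N.
  by move: j0; rewrite hc expn_gt0 [k == 0%N]gtn_eqF // orbF.
have : (1 = N)%N.
  apply: (@reduced_eq k 1 N a c) => //; first exact: reduced1.
  by rewrite muln1 -hc.
by move=> N1; move: N2; rewrite -N1; have := expn_gt0 2 k; lia.
Qed.

Lemma Sk_S_of (n : nat) : Sk k n -> S_of k (@Lambda R k) n.
Proof.
move=> [[n0 full] npow].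
pose v p := logn p n.
pose b i := (\prod_(p <- primes n) p ^ (v p %% k == i))%N.
(* If v = qk + r with r > 0, the prime goes into b_r, which already carries k + r, so only q - 1
   copies are left for [a]; k-fullness gives q >= 1. *)
pose a := (\prod_(p <- primes n) p ^ (if v p %% k == 0 then v p %/ k else (v p %/ k).-1))%N.
have pr : all prime (primes n) by apply/allP => p; rewrite mem_primes => /andP[].
have up := primes_uniq n.
have pos f : (0 < \prod_(p <- primes n) p ^ f p)%N.
  rewrite big_seq prodn_cond_gt0 // => p pn.
  by rewrite expn_gt0 prime_gt0 // (allP pr).
have lb q i : (0 < i)%N -> logn q (b i) = (v q %% k == i)%N.
  move=> i0; rewrite logn_prod_primes //; case: ifP => //.
  move=> /negbT qn; have : v q = 0%N by apply/eqP; rewrite -leqn0 leqNgt logn_gt0.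
  by move=> ->; rewrite mod0n; case: i i0.
have lprod q : logn q (\prod_(1 <= i < k) b i)%N = (\sum_(1 <= i < k) (v q %% k == i) * 1)%N.
  rewrite logn_big_prod; last by move=> i; exact: pos.
  by apply: eq_big_nat => i /andP[i1 _]; rewrite lb // muln1.
have nE : n = (a ^ k * \prod_(1 <= i < k) b i ^ (k + i))%N.
  have bp : (0 < \prod_(1 <= i < k) b i ^ (k + i))%N.
    by rewrite prodn_gt0 // => i; rewrite expn_gt0 pos.
  apply: eqn_from_log => //; first by rewrite muln_gt0 expn_gt0 pos.
  move=> q; rewrite lognM ?expn_gt0 ?pos // lognX logn_prod_primes //.
  rewrite logn_big_prod; last by move=> i; rewrite expn_gt0 pos.
  rewrite (eq_big_nat _ _ (F2 := fun i => (v q %% k == i) * (k + i))%N); last first.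
    by move=> i /andP[i1 _]; rewrite lognX lb // mulnC.
  rewrite sum_nat_delta ltn_pmod // andbT -/(v q).
  case: ifP => [qn|/negbT qn]; last first.
    have -> : v q = 0%N by apply/eqP; rewrite -leqn0 leqNgt logn_gt0.
    by rewrite mod0n muln0.
  have vk : (k <= v q)%N.
    have qp := allP pr _ qn; rewrite -pfactor_dvdn //; apply: full => //.
    by move: qn; rewrite mem_primes => /and3P[].
  rewrite [in LHS](divn_eq (v q) k).
  have d1 : (0 < v q %/ k)%N by rewrite divn_gt0.
  case: (v q %% k)%N => [|r] /=; first by rewrite mulnC.
  by case: (v q %/ k)%N d1 => // d _ /=; rewrite mulSn mulnC; lia.
exists a; split; first exact: pos.
exists ((\prod_(1 <= i < k) b i ^ (k + i))%N%:R `^ k%:R^-1); last first.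
  by rewrite exprMn powR_invX // -natrX -natrM -nE.
exists b; split; first by move=> i _; exact: pos.
have Pp : (0 < \prod_(1 <= i < k) b i)%N by rewrite prodn_gt0 // => i; exact: pos.
split.
  rewrite ltnNge; apply/negP => le1; apply: npow; exists a.
  rewrite [LHS]nE big_nat big1 ?muln1 // => i hi.
  have : (b i %| \prod_(1 <= i < k) b i)%N.
    by rewrite (bigD1_seq i) ?iota_uniq ?mem_index_iota //= dvdn_mulr.
  have -> : (\prod_(1 <= i < k) b i = 1)%N by apply/eqP; rewrite eqn_leq le1.
  by rewrite dvdn1 => /eqP ->; rewrite exp1n.
split=> // p pp; rewrite -[(p * p)%N]/(p ^ 2)%N pfactor_dvdn // -ltnNge lprod.
by rewrite sum_nat_delta; case: ifP.
Qed.

(** With b_1 = p prime and the other b_i equal to 1, lambda = p^(1 + 1/k) exceeds p. Choosing p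
    beyond the sum of a supposedly finite Lambda is a contradiction. *)
Lemma Lambda_infinite : infinite_set (@Lambda R k).
Proof.
move=> fin; pose F := fset_set (@Lambda R k).
have memF x : @Lambda R k x -> x \in F by move=> h; rewrite in_fset_set // inE.
pose M := \sum_(x <- F) x.
have [p pM pp] := prime_above (Num.truncn M).
pose b i := (if i == 1 then p else 1)%N.
pose x : R := ((\prod_(1 <= i < k) b i ^ (k + i))%N%:R) `^ (k%:R^-1).
have P1 : (\prod_(1 <= i < k) b i = p)%N.
  rewrite (bigD1_seq 1%N) ?iota_uniq ?mem_index_iota //= big1 ?muln1 // => i.
  by rewrite /b => /negPf ->.
have xL : @Lambda R k x.
  exists b; split; first by move=> i _; rewrite /b; case: ifP => // _; exact: prime_gt0.
  split; first by rewrite P1 prime_gt1.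
  split=> //; rewrite P1 => q qp; apply/negP => qq.
  have := dvdn_trans (dvdn_mulr q (dvdnn q)) qq; rewrite dvdn_prime2 // => /eqP qE.
  have := dvdn_leq (prime_gt0 pp) qq; rewrite qE.
  by rewrite -[X in (_ <= X)%N]muln1 leq_pmul2l ?prime_gt0 // leqNgt prime_gt1.
have P2 : (\prod_(1 <= i < k) b i ^ (k + i) = p ^ k.+1)%N.
  rewrite (bigD1_seq 1%N) ?iota_uniq ?mem_index_iota //= addn1 big1 ?muln1 // => i.
  by rewrite /b => /negPf ->; rewrite exp1n.
have xp : p%:R < x.
  have x0 : 0 < x by have := Lambda_gt2 xL; lra.
  rewrite -(ltr_pXn2r k0) ?nnegrE ?(ltW x0) // powR_invX // P2 -natrX ltr_nat.
  by rewrite ltn_exp2l ?prime_gt1.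
have Mx : x <= M.
  rewrite /M (bigD1_seq x) ?memF ?fset_uniq //= lerDl big_seq_cond sumr_ge0 // => y.
  move=> /andP[]; rewrite in_fset_set // inE => /Lambda_gt2 y2 _; lra.
have := real_truncnS_gt (num_real M); apply/negP; rewrite -leNgt.
by apply: le_trans (ltW (lt_le_trans xp Mx)); rewrite ler_nat.
Qed.

(** * Convergence of the sum of 1/lambda *)

Let rho (n : nat) : R := n%:R `^ k%:R^-1.
(** The term n^(-(1 + 1/k)) of a convergent series; [w 0] is 0 because the inverse of 0 is 0. *)
Let w (n : nat) : R := (n%:R * rho n)^-1.

Let rho_gt0 n : (0 < n)%N -> 0 < rho n.
Proof. by move=> n0; rewrite powR_gt0 // ltr0n. Qed.

Let rhoX n : rho n ^+ k = n%:R.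
Proof. by rewrite powR_invX. Qed.

Let w_ge0 n : 0 <= w n.
Proof. by rewrite invr_ge0 mulr_ge0 ?powR_ge0. Qed.

(* With u = n^(1/k), v = (n+1)^(1/k), the factorisation of v^k - u^k = 1 gives
   v - u >= 1 / (k v^(k-1)). *)
Let w_telescope n : (0 < n)%N -> w n.+1 <= k%:R * ((rho n)^-1 - (rho n.+1)^-1).
Proof.
move=> n0; have u0 := rho_gt0 n0; have v0 : 0 < rho n.+1 by apply: rho_gt0.
have uX := rhoX n; have vX := rhoX n.+1.
rewrite /w -vX; move: u0 v0 uX vX; set u := rho n; set v := rho n.+1 => u0 v0 uX vX.
have uv : u < v by rewrite -(ltr_pXn2r k0) ?nnegrE ?ltW // uX vX ltr_nat.
have E : 1 = (v - u) * \sum_(i < k) v ^+ (k.-1 - i) * u ^+ i.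
  by rewrite -subrXX uX vX -natr1 addrAC subrr add0r.
have B : \sum_(i < k) v ^+ (k.-1 - i) * u ^+ i <= k%:R * v ^+ k.-1.
  rewrite -[k in k%:R]card_ord -sum1_card natr_sum mulr_suml; apply: ler_sum => i _.
  rewrite mul1r -[in X in _ <= X](@subnK i k.-1); last by rewrite -ltnS prednK.
  rewrite exprD ler_pM2l ?exprn_gt0 //.
  by rewrite lerXn2r ?nnegrE ?ltW.
have h : 1 <= (v - u) * (k%:R * v ^+ k.-1) by rewrite {1}E ler_wpM2l // subr_ge0 ltW.
have -> : u^-1 - v^-1 = (v - u) / (u * v).
  by rewrite invfM mulrBl mulrCA divff ?gt_eqF // mulr1 mulVKf ?gt_eqF.
rewrite mulrA ler_pdivlMr ?mulr_gt0 // mulrC ler_pdivrMr ?mulr_gt0 ?exprn_gt0 //.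
have -> : v ^+ k = v * v ^+ k.-1 by rewrite -exprS prednK.
have : 0 <= ((v - u) * (k%:R * v ^+ k.-1) - 1) * (v * v).
  by rewrite mulr_ge0 ?subr_ge0 // mulr_ge0 // ltW.
have : 0 <= (v - u) * v by rewrite mulr_ge0 ?subr_ge0 // ltW.
by lra.
Qed.

Let sum_w B : \sum_(n < B.+1) w n <= k%:R + 1.
Proof.
have w0 : w 0 = 0 by rewrite /w mul0r invr0.
have rho1 : rho 1 = 1 by rewrite /rho powR1.
have w1 : w 1 = 1 by rewrite /w rho1 mulr1 invr1.
case: B => [|B]; first by rewrite big_ord_recl big_ord0 /= w0 !addr0 ltW // ltr_wpDl.
have : \sum_(n < B.+2) w n <= 1 + k%:R * (1 - (rho B.+1)^-1).
  elim: B => [|B IH].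
    by rewrite !big_ord_recl big_ord0 /= w0 w1 rho1 invr1; lra.
  rewrite big_ord_recr /=; apply: le_trans (lerD IH (w_telescope _)) _ => //.
  by lra.
have : 0 <= k%:R * (rho B.+1)^-1 by rewrite mulr_ge0 ?invr_ge0 ?powR_ge0.
by lra.
Qed.

(** Each exponent 1 + i/k in lambda is at least 1 + 1/k. *)
Let inv_le (x : R) b : (forall i, (1 <= i < k)%N -> (0 < b i)%N) ->
  x = (\prod_(1 <= i < k) b i ^ (k + i))%N%:R `^ k%:R^-1 ->
  x^-1 <= \prod_(i < k.-1) w (b i.+1).
Proof.
move=> b0 xE.
have x0 : 0 < x by rewrite xE powR_gt0 // ltr0n lambda_val_gt0.
have bp (i : 'I_k.-1) : (0 < b i.+1)%N.
  by apply: b0; have := ltn_ord i; rewrite -ltnS prednK.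
have -> : \prod_(i < k.-1) w (b i.+1) = (\prod_(i < k.-1) ((b i.+1)%:R * rho (b i.+1)))^-1.
  by rewrite -prodfV.
have y0 : 0 < \prod_(i < k.-1) ((b i.+1)%:R * rho (b i.+1)).
  by apply: prodr_gt0 => i _; rewrite mulr_gt0 ?ltr0n ?rho_gt0.
rewrite lef_pV2 ?posrE // -(ler_pXn2r k0) ?nnegrE ?(ltW x0) ?(ltW y0) //.
rewrite {1}xE powR_invX // big_add1 big_mkord natr_prod -prodrXl.
apply: ler_prod => i _; rewrite exprMn rhoX.
rewrite mulr_ge0 ?exprn_ge0 //= -natrX -natrM ler_nat -expnSr.
by rewrite leq_pexp2l // addnS ltnS leq_addr.
Qed.

(** The elements of [F] inject into tuples of length k - 1 with entries at most [B], and the sum of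
    the product of the [w] over all tuples factors into k - 1 sums, each bounded independently of
    [B]. *)
Theorem Lambda_inv_summable : exists C : R, forall F : seq R, uniq F ->
  (forall x, x \in F -> @Lambda R k x) -> \sum_(x <- F) x^-1 <= C.
Proof.
exists ((k%:R + 1) ^+ k.-1) => F uF FL.
have hb x : exists b : nat -> nat, x \in F ->
    (forall i, (1 <= i < k)%N -> (0 < b i)%N) /\
    x = (\prod_(1 <= i < k) b i ^ (k + i))%N%:R `^ k%:R^-1.
  have [xF|xF] := boolP (x \in F); last by exists id.
  by have [b [b0 [_ [_ xE]]]] := FL _ xF; exists b.
have [b {}hb] := choice hb.
pose B := (\max_(x <- F) \max_(i < k.-1) b x i.+1)%N.
have bB x (i : 'I_k.-1) : x \in F -> (b x i.+1 < B.+1)%N.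
  move=> xF; rewrite ltnS /B; apply: leq_trans (leq_bigmax_seq _ xF isT).
  exact: (@leq_bigmax _ (fun i : 'I_k.-1 => b x i.+1)).
pose g x : {ffun 'I_k.-1 -> 'I_B.+1} := [ffun i : 'I_k.-1 => inord (b x i.+1)].
pose W (f : {ffun 'I_k.-1 -> 'I_B.+1}) : R := \prod_i w (f i).
have gW x : x \in F -> x^-1 <= W (g x).
  move=> xF; have [b0 xE] := hb _ xF; apply: le_trans (inv_le b0 xE) _.
  rewrite le_eqVlt; apply/orP; left; apply/eqP; apply: eq_bigr => i _.
  by rewrite ffunE inordK // bB.
have g_inj : {in F &, injective g}.
  move=> x y xF yF /ffunP gxy.
  have [_ ->] := hb _ xF; have [_ ->] := hb _ yF; congr (_%:R `^ _).
  rewrite !big_add1 !big_mkord; apply: eq_bigr => i _; congr (_ ^ _)%N.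
  by have := gxy i; rewrite !ffunE => /(congr1 val) /=; rewrite !inordK ?bB.
apply: (@le_trans _ _ (\sum_(x <- F) W (g x))).
  by rewrite big_seq [X in _ <= X]big_seq; apply: ler_sum => x /gW.
rewrite -(big_map g xpredT W) big_uniq ?map_inj_in_uniq //=.
apply: (@le_trans _ _ (\sum_f W f)).
  rewrite [X in X <= _]big_mkcond; apply: ler_sum => f _; case: ifP => // _.
  by apply: prodr_ge0 => i _; apply: w_ge0.
rewrite -(bigA_distr_bigA (fun _ j => w (nat_of_ord j))) /= prodr_const card_ord.
by rewrite lerXn2r ?nnegrE ?sum_w ?addr_ge0 // sumr_ge0 // => i _; apply: w_ge0.
Qed.

End LambdaFacts.

(** * Multiples in unit intervals *)

Section PartitionMeans.
Variable R : realType.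

(* The lower bounds add up to the mean of the whole, so each of them is sharp. *)
Lemma has_mean_partition (I : finType) (u : I -> nat -> R) (m : I -> R) (w : nat -> R) :
  (forall n, \sum_i u i n = w n) -> has_mean w (\sum_i m i) ->
  (forall i e, 0 < e -> \forall N \near \oo, (m i - e) * N%:R <= \sum_(n < N) u i n.+1) ->
  forall i, has_mean (u i) (m i).
Proof.
move=> uw mw low i; apply/cvgrPdist_le => e e0.
(* The upper bound for [u i] combines the error for the whole with those of the other indices, at
   most #|I| + 1 errors of size e / K. *)
pose K : R := #|I|.+1%:R; have K0 : 0 < K by rewrite ltr0n.
have e1 : 0 < e / K by rewrite divr_gt0.
have lowall : \forall N \near \oo, forall j, (m j - e / K) * N%:R <= \sum_(n < N) u j n.+1.
  by apply: filter_forall => j; apply: low.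
move/cvgrPdist_le : mw => /(_ _ e1) mw.
near=> N.
have N0 : 0 < N%:R :> R by near: N; exact: nbhs_infty_gtr.
have lowN : forall j, (m j - e / K) * N%:R <= \sum_(n < N) u j n.+1 by near: N.
have : `|\sum_j m j - (\sum_(n < N) w n.+1) / N%:R| <= e / K by near: N.
rewrite ler_norml => /andP[hw0 _].
have hw : \sum_(n < N) w n.+1 <= (\sum_j m j + e / K) * N%:R.
  by rewrite -ler_pdivrMr // -lerBlDl -opprB lerNl.
have eK : e / K * K = e by rewrite divfK // gt_eqF.
have lower : m i - e <= (\sum_(n < N) u i n.+1) / N%:R.
  rewrite ler_pdivlMr //; apply: le_trans (lowN i); rewrite ler_pM2r // lerD2l lerN2.
  by rewrite ler_pdivrMr // ler_peMr ?(ltW e0) // /K ler1n.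
have upper : (\sum_(n < N) u i n.+1) / N%:R <= m i + e.
  rewrite ler_pdivrMr //.
  have -> : \sum_(n < N) u i n.+1 =
      \sum_(n < N) w n.+1 - \sum_(j | j != i) \sum_(n < N) u j n.+1.
    rewrite exchange_big -sumrB; apply: eq_bigr => n _.
    by rewrite -uw (bigD1 i) //= addrK.
  have : \sum_(j | j != i) (m j - e / K) * N%:R <= \sum_(j | j != i) \sum_(n < N) u j n.+1.
    by apply: ler_sum => j _; apply: lowN.
  rewrite -mulr_suml sumrB => h.
  have E : \sum_(j | j != i) e / K + e / K <= e.
    rewrite -[X in _ <= X]eK /K -natr1 mulrDr mulr1 lerD2r.
    have -> : e / (#|I|%:R + 1) * #|I|%:R = \sum_(j : I) e / (#|I|%:R + 1).
      by rewrite sumr_const mulr_natr.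
    rewrite natr1 [X in X <= _]big_mkcond; apply: ler_sum => j _.
    by case: ifP => // _; apply: ltW.
  have : 0 <= (e - (\sum_(j | j != i) e / K + e / K)) * N%:R by rewrite mulr_ge0 ?subr_ge0.
  move: hw h; rewrite [\sum_j m j](bigD1 i) //=.
  move: (\sum_(j | j != i) m j) (\sum_(j | j != i) e / K) (e / K) (\sum_(n < N) w n.+1).
  move: (\sum_(j | j != i) \sum_(n < N) u j n.+1) (N%:R) (m i) => a b c d f g h.
  by lra.
move: lower upper; move: ((\sum_(n < N) u i n.+1) / N%:R) => z l1 l2.
by rewrite ler_norml; apply/andP; split; lra.
Unshelve. all: by end_near. Qed.

End PartitionMeans.

Section Hits.
Variable R : realType.

Definition hit (x : R) (n : nat) : Prop :=
  exists a : nat, n%:R < a%:R * x < n.+1%:R.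

Lemma hit_lt (x : R) n : 0 < x -> hit x n -> x < n.+1%:R.
Proof.
move=> x0 [[|a] /andP[h1 h2]].
  by move: h1; rewrite mul0r ltNge ler0n.
by apply: le_lt_trans h2; rewrite ler_peMl ?(ltW x0) // ler1n.
Qed.

Lemma hit_disjoint (x : R) n : 2 < x -> hit x n -> ~ hit x n.+1.
Proof.
move=> x2 [a /andP[a1 a2]] [b /andP[b1 b2]].
have ab : (a < b)%N.
  by rewrite -(ltr_nat R) -(@ltr_pM2r _ x) ?(lt_trans a2 b1) //; lra.
have : a.+1%:R * x <= b%:R * x by rewrite ler_pM2r ?ler_nat //; lra.
by move: a1 b2; rewrite -!natr1 mulrDl mul1r; lra.
Qed.

(** A hit at M comes from a multiple of x strictly between M and M + 1, so floor((M + 1)/x) is then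
    larger than floor(M/x). *)
Lemma count_hit_le (x : R) (M : nat) : 0 < x ->
  \sum_(n < M) (`[< hit x n >])%:R <= M%:R / x.
Proof.
move=> x0; have Mx (m : nat) : 0 <= m%:R / x by rewrite divr_ge0 // ltW.
apply: (@le_trans _ _ (Num.truncn (M%:R / x))%:R); last by rewrite truncn_le.
rewrite -natr_sum ler_nat; elim: M => [|M IH]; first by rewrite big_ord0.
rewrite big_ord_recr /=; case: asboolP => [[a /andP[a1 a2]]|_]; last first.
  by rewrite addn0; apply: leq_trans IH _; apply: le_truncn; rewrite ler_pM2r ?invr_gt0 ?ler_nat.
rewrite addn1; apply: leq_ltn_trans IH _; apply: (@leq_trans a).
  by rewrite truncn_lt_nat // ltr_pdivrMr.
by rewrite truncn_ge_nat // ler_pdivlMr // ltW.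
Qed.

(* Class 1: a multiple of x in (n, n+1); class 2: one in (n+1, n+2); class 0:
   neither. The class is read off the position of the fractional part of n / x
   relative to 1 - 2/x and 1 - 1/x. *)
Definition hit_class (x : R) (n : nat) : 'I_3 :=
  if `[< hit x n >] then inord 1 else if `[< hit x n.+1 >] then inord 2 else ord0.

Definition class_lo (x : R) (c : 'I_3) : R :=
  match val c with 0 => 0 | 1 => 1 - x^-1 | _ => 1 - 2 / x end.
Definition class_hi (x : R) (c : 'I_3) : R :=
  match val c with 0 => 1 - 2 / x | 1 => 1 | _ => 1 - x^-1 end.
Definition class_size (x : R) (c : 'I_3) : R :=
  if c == ord0 then 1 - 2 / x else x^-1.

Lemma class_sizeE x c : class_hi x c - class_lo x c = class_size x c.
Proof.
case: c => -[|[|[|c]]] //= hc; rewrite /class_hi /class_lo /class_size /=.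
- by rewrite subr0.
- by rewrite opprB addrC subrK.
- by lra.
Qed.

Lemma sum_class_size x : \sum_c class_size x c = 1.
Proof. by rewrite !big_ord_recl big_ord0 /class_size /=; lra. Qed.

Lemma class_bounds x c : 2 < x ->
  [/\ 0 <= class_lo x c, class_lo x c <= class_hi x c & class_hi x c <= 1].
Proof.
move=> x2; have t0 : 0 < x^-1 by rewrite invr_gt0; lra.
have t2 : x^-1 < 2^-1 by rewrite ltf_pV2 ?posrE //; lra.
by case: c => -[|[|[|c]]] //= hc; rewrite /class_hi /class_lo /=; split; lra.
Qed.

(** As 1/x < 1/2, the only possible multiplier for either window is floor(y) + 1. The boxes contain
    their left endpoint while hits are strict; [irr] excludes equality. *)
Lemma box_hit_class x c n : 2 < x ->
  (forall m : nat, (0 < m)%N -> m%:R * x^-1 \isn't a Num.int) ->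
  in_box (class_lo x c) (class_hi x c) (n.+1%:R * x^-1) -> hit_class x n.+1 = c.
Proof.
move=> x2 irr; set t := x^-1; set y := n.+1%:R * t.
have x0 : 0 < x by lra.
have t0 : 0 < t by rewrite invr_gt0.
have t2 : t < 2^-1 by rewrite ltf_pV2 ?posrE //; lra.
have y0 : 0 <= y by rewrite mulr_ge0 // ltW.
have [f hf] : exists f : nat, Num.floor y = f%:Z.
  exists `|Num.floor y|%N; rewrite gez0_abs //; rewrite real_floor_ge0 ?num_real //.
have fr : frac y = y - f%:R by rewrite /frac hf.
have gtf (a : nat) : y < a%:R -> f.+1%:R <= a%:R :> R.
  move=> ya; rewrite ler_nat -(ltr_nat R); apply: le_lt_trans ya.
  by have := frac_ge0 y; rewrite fr subr_ge0.
have hitE (m : nat) (a : nat) : (m%:R < a%:R * x < m.+1%:R) = (m%:R * t < a%:R < m.+1%:R * t).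
  by rewrite ltr_pdivrMr // ltr_pdivlMr.
have yS (m : nat) : (m.+1)%:R * t = m%:R * t + t by rewrite -natr1 mulrDl mul1r.
have hit1 : hit x n.+1 -> 1 - t < frac y.
  move=> [a]; rewrite hitE (yS n.+1) -/y => /andP[/gtf a1 a2].
  by rewrite fr; move: a1; rewrite -natr1; lra.
have hit2 : hit x n.+2 -> 1 - 2 * t < frac y.
  move=> [a]; rewrite hitE (yS n.+2) (yS n.+1) -/y => /andP[a1 a2].
  have /gtf : y < a%:R by lra.
  by rewrite fr -natr1; lra.
have irr' (m a : nat) : (0 < m)%N -> a%:R != m%:R * t.
  by move=> m0; apply: contraNneq (irr m m0) => <-; rewrite intr_nat ?natr_nat.
have flt := frac_lt1 y.
rewrite /in_box; case: c => -[|[|[|c]]] // hc; rewrite /class_lo /class_hi /= -/t => /andP[h1 h2].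
- rewrite /hit_class asboolF; last by move=> /hit1; lra.
  by rewrite asboolF; [apply: val_inj|move=> /hit2; lra].
- rewrite /hit_class asboolT; first by apply: val_inj; rewrite /= inordK.
  exists f.+1; rewrite hitE; have := irr' n.+2 f.+1 isT; rewrite (yS n.+1) -/y.
  move: h1; rewrite fr in flt h2 *; rewrite lt_neqAle [_ < _ + _]lt_neqAle => h1 ->.
  by rewrite -natr1 /=; apply/andP; split; lra.
- have nh : ~ hit x n.+1 by move=> /hit1; lra.
  rewrite /hit_class asboolF // asboolT; first by apply: val_inj; rewrite /= inordK.
  exists f.+1; rewrite hitE; have := irr' n.+3 f.+1 isT; rewrite (yS n.+2) (yS n.+1) -/y => ne.
  rewrite fr in h1 h2; rewrite [_ < _ + _]lt_neqAle ne -natr1 /=.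
  by apply/andP; split; lra.
Qed.

End Hits.

(** * Densities of values of a sequence *)

Section PointDensities.
Variables (R : realType) (T : choiceType) (P : nat -> T) (v : T -> R) (D : set T).
Hypothesis vP : forall p, D p -> has_mean (fun n => (P n == p)%:R) (v p).
Hypothesis tight : forall e : R, 0 < e -> exists K : seq T,
  \forall N \near \oo, \sum_(n < N) (P n.+1 \notin K)%:R <= e * N%:R.

Lemma has_mean_mem (s : seq T) : uniq s -> (forall p, p \in s -> D p) ->
  has_mean (fun n => (P n \in s)%:R) (\sum_(p <- s) v p).
Proof.
elim: s => [|p s IH] /= us sD.
  by rewrite big_nil; apply: (has_mean_eq _ (@has_mean_cst R 0)) => n.
have /andP[ps us'] := us; rewrite big_cons.
apply: (has_mean_eq _ (has_meanD (vP (sD p (mem_head _ _))) (IH us' _))) => [n|q qs]; last first.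
  by apply: sD; rewrite inE qs orbT.
rewrite inE; case: eqP => [->|_] /=; last by rewrite add0r.
by rewrite (negPf ps) addr0.
Qed.

Lemma has_mean_le (u w : nat -> R) c d : has_mean u c -> has_mean w d ->
  (forall n, u n <= w n) -> c <= d.
Proof.
move=> hu hw uw; apply: (ler_cvg_to hu hw); near=> N.
by rewrite ler_wpM2r ?invr_ge0 // ler_sum.
Unshelve. all: by end_near. Qed.

Let sums := [set x | exists s : seq T,
  [/\ uniq s, forall p, p \in s -> D p & x = \sum_(p <- s) v p]].

Let sums_le1 x : sums x -> x <= 1.
Proof.
move=> [s [us sD ->]]; apply: (has_mean_le (has_mean_mem us sD) (@has_mean_cst R 1)) => n.
by case: (_ \in _); rewrite ?lexx ?ler01.
Qed.

Let v_ge0 p : D p -> 0 <= v p.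
Proof. by move=> Dp; apply: (has_mean_le (@has_mean_cst R 0) (vP Dp)) => n. Qed.

Let has_sup_sums : has_sup sums.
Proof.
split; first by exists 0; exists [::]; split=> //; rewrite big_nil.
by exists 1 => x /sums_le1.
Qed.

(** Finite sums of [v] over D are densities of finite sets of values, so d, their supremum, bounds
    the density from below. Tightness prevents mass from escaping along ever new values and gives
    the upper bound. The last clause serves to prove d positive. *)
Lemma point_densities : exists d : R,
  [/\ has_mean (fun n => (`[< D (P n) >])%:R) d,
      (\esum_(p in D) (v p)%:E)%E = d%:E & forall p, D p -> v p <= d].
Proof.
pose d := sup sums.
have ub x : sums x -> x <= d by move=> h; apply: sup_upper_bound => //; exact: has_sup_sums.
exists d; split; last first.
- by move=> p Dp; apply: ub; exists [:: p]; split=> [//|q|]; rewrite ?big_seq1 // inE => /eqP ->.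
- apply/eqP; rewrite eq_le; apply/andP; split.
    apply: ub_ereal_sup => _ [A [finA AD] <-].
    rewrite fsbig_finite //= sumEFin lee_fin; apply: ub.
    exists (fset_set A); split=> // p; rewrite in_fset_set // inE; exact: AD.
  have esum_ge_sum x : sums x -> (x%:E <= \esum_(p in D) (v p)%:E)%E.
    move=> [s [us sD ->]]; apply: esum_ge; exists [set` s]; first by split=> // p /sD.
    by rewrite -fsbig_seq // sumEFin.
  have : (0 <= \esum_(p in D) (v p)%:E)%E by apply: esum_ge0 => p Dp; rewrite lee_fin v_ge0.
  case E : (esum _ _) => [r| |] // _; rewrite ?leey //.
  rewrite lee_fin; apply: ge_sup; first by case: has_sup_sums.
  by move=> x /esum_ge_sum; rewrite E lee_fin.
apply/cvgrPdist_le => e e0.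
have e4 : 0 < e / 4 by rewrite divr_gt0.
have [_ [s0 [us0 s0D ->]] hs0] := sup_adherent e4 has_sup_sums.
have [K hK] := tight e4.
(* [s0] makes the sum nearly d, and adding all of K in D ensures that a value in D outside [s] lies
   outside [K]. *)
pose s := undup (s0 ++ [seq p <- K | `[< D p >]]).
have us : uniq s by apply: undup_uniq.
have sD p : p \in s -> D p.
  rewrite mem_undup mem_cat => /orP[/s0D //|].
  by rewrite mem_filter => /andP[/asboolP].
have sumle : \sum_(p <- s0) v p <= \sum_(p <- s) v p.
  rewrite [X in _ <= X](bigID (mem s0)) /=.
  rewrite -[X in X <= _]addr0 lerD //.
    rewrite le_eqVlt; apply/orP; left; apply/eqP; rewrite -[RHS]big_filter.
    apply: perm_big; apply: uniq_perm => //; first exact: filter_uniq.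
    by move=> p; rewrite mem_filter mem_undup mem_cat andb_orr andbb; case: (p \in s0).
  by rewrite big_seq_cond sumr_ge0 // => p /andP[/sD /v_ge0].
have sumd : \sum_(p <- s) v p <= d by apply: ub; exists s.
have /cvgrPdist_le/(_ _ e4) ms := has_mean_mem us sD.
near=> N.
have N0 : 0 < N%:R :> R by near: N; exact: nbhs_infty_gtr.
have : `|\sum_(p <- s) v p - (\sum_(n < N) (P n.+1 \in s)%:R) / N%:R| <= e / 4 by near: N.
have : (\sum_(n < N) (P n.+1 \notin K)%:R) / N%:R <= e / 4.
  by rewrite ler_pdivrMr //; near: N.
have : (\sum_(n < N) (P n.+1 \in s)%:R) / N%:R <= (\sum_(n < N) (`[< D (P n.+1) >])%:R) / N%:R :> R.
  rewrite ler_pM2r ?invr_gt0 //; apply: ler_sum => n _.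
  by case: asboolP => // h; [case: (_ \in _)|rewrite (_ : (_ \in _) = false) //; apply/negP => /sD].
have : (\sum_(n < N) (`[< D (P n.+1) >])%:R) / N%:R <=
   (\sum_(n < N) (P n.+1 \in s)%:R) / N%:R + (\sum_(n < N) (P n.+1 \notin K)%:R) / N%:R :> R.
  rewrite -mulrDl ler_pM2r ?invr_gt0 // -big_split; apply: ler_sum => n _ /=.
  case: asboolP => h; last by rewrite addr_ge0.
  rewrite mem_undup mem_cat mem_filter asboolT //=.
  by case: (P n.+1 \in s0); case: (P n.+1 \in K); rewrite /= ?addr0 ?add0r ?lerDl.
move: hs0 sumle sumd; rewrite -/d.
move: (\sum_(p <- s0) v p) (\sum_(p <- s) v p) ((\sum_(n < N) (P n.+1 \in s)%:R) / N%:R).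
move: ((\sum_(n < N) (P n.+1 \notin K)%:R) / N%:R) ((\sum_(n < N) (`[< D (P n.+1) >])%:R) / N%:R).
move=> a b c f g; rewrite !ler_norml => ? ? ? ? ? ? /andP[? ?].
by apply/andP; split; lra.
Unshelve. all: by end_near. Qed.

End PointDensities.

(** * Sparse sets of independent reals *)

Section SparseSet.
Variables (R : realType) (L : set R).
Hypothesis L2 : forall x, L x -> 2 < x.
Hypothesis Lind : forall s : seq R, uniq s -> (forall x, x \in s -> L x) ->
  forall h, int_comb (fun x : R => x^-1) s h \is a Num.int -> forall x, x \in s -> h x = 0.
Hypothesis Lsum : exists C : R, forall s : seq R, uniq s -> (forall x, x \in s -> L x) ->
  \sum_(x <- s) x^-1 <= C.

Let Lgt0 x : L x -> 0 < x.
Proof. by move=> /L2; lra. Qed.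

Let L_irrational x (m : nat) : L x -> (0 < m)%N -> m%:R * x^-1 \isn't a Num.int.
Proof.
move=> Lx m0; apply/negP => h.
have := @Lind [:: x] isT _ (fun=> m%:Z); rewrite /int_comb big_seq1 -pmulrn => H.
suff : m%:Z = 0 by move=> [] m0'; rewrite m0' in m0.
by apply: (H _ h x (mem_head _ _)) => y; rewrite inE => /eqP ->.
Qed.

(** By induction, the mean for the tail of the list is known; it splits over the three classes of
    the first element, for each of which a box gives a lower bound. *)
Lemma hit_class_mean (s : seq R) (f : R -> 'I_3) : uniq s -> (forall x, x \in s -> L x) ->
  has_mean (fun n => (all (fun x => hit_class x n == f x) s)%:R)
    (\prod_(x <- s) class_size x (f x)).
Proof.
elim: s => [|x s IH] us sL.
  by rewrite big_nil; apply: (has_mean_eq _ (@has_mean_cst R 1)) => n.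
have /andP[xs us'] := us; rewrite big_cons.
have {}IH := IH us' (fun y ys => sL y (mem_behead (ys : y \in behead (x :: s)))).
set V := \prod_(y <- s) _ in IH *.
pose u c n : R := ((hit_class x n == c) && all (fun y => hit_class y n == f y) s)%:R.
apply: (@has_mean_partition R 'I_3 u (fun c => class_size x c * V)
  (fun n => (all (fun y => hit_class y n == f y) s)%:R) _ _ _ (f x)).
- move=> n; rewrite /u (bigD1 (hit_class x n)) //= eqxx big1 ?addr0 // => c.
  by rewrite eq_sym => /negPf ->.
- by rewrite -mulr_suml sum_class_size mul1r.
move=> c e e0.
pose f' y := if y == x then c else f y.
(* Off the list both endpoints are 0, since the box estimate requires valid endpoints at every
   index. *)
pose a y := if y \in x :: s then class_lo y (f' y) else 0.
pose b y := if y \in x :: s then class_hi y (f' y) else 0.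
have ab y : [/\ 0 <= a y, a y <= b y & b y <= 1].
  by rewrite /a /b; case: ifP => [/sL /L2 y2|_]; [exact: class_bounds | split].
have := @box_lower_density R R (fun y => y^-1) a b (x :: s) e us (Lind us sL) ab e0.
apply: filterS => N.
have -> : \prod_(y <- x :: s) (b y - a y) = class_size x c * V.
  rewrite big_cons /a /b mem_head class_sizeE /f' eqxx; congr (_ * _).
  apply: eq_big_seq => y ys; rewrite inE ys orbT class_sizeE.
  by case: eqP => // yx; rewrite -yx ys in xs.
move=> /le_trans; apply; apply: ler_sum => n _; rewrite /u.
case: allP => [h|_]; last by [].
have hy y : y \in x :: s -> hit_class y n.+1 = f' y.
  move=> ys; have Ly := sL _ ys; apply: box_hit_class; first exact: L2.
    by move=> m m0; apply: L_irrational.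
  by have := h _ ys; rewrite /a /b ys.
rewrite hy ?mem_head // {1}/f' eqxx eqxx /=.
rewrite (_ : all _ _) //; apply/allP => y ys.
rewrite hy ?inE ?ys ?orbT // /f'.
by case: (y =P x) => // yx; rewrite -yx ys in xs.
Qed.

(** Each element up to X contributes at least 1/X to a bounded sum. *)
Lemma finite_L_le (X : R) : finite_set (L `&` [set y | y <= X]).
Proof.
apply: contrapT => /infinite_set_fset inf; have [C hC] := Lsum.
have [B BL] := inf (Num.truncn (C * X)).+1.
have X0 : B != fset0 -> 0 < X.
  by move=> /fset0Pn[x /BL [/Lgt0 x0 /(lt_le_trans x0)]].
case: (eqVneq B fset0) => [->|/X0 {}X0]; first by rewrite cardfs0.
move=> sz; have := hC _ (fset_uniq B) (fun x xB => (BL x xB).1).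
apply/negP; rewrite -ltNge.
apply: (@lt_le_trans _ _ (\sum_(x <- B) X^-1)); last first.
  rewrite big_seq [X in _ <= X]big_seq; apply: ler_sum => x /BL /= [Lx xX].
  by rewrite lef_pV2 ?posrE ?(Lgt0 Lx).
rewrite big_const_seq count_predT -Monoid.iteropE -[iterop _ _ _ _]/(X^-1 *+ _).
rewrite -mulr_natl ltr_pdivlMr //; apply: lt_le_trans (real_truncnS_gt (num_real _)) _.
by rewrite ler_nat.
Qed.

Definition upto (X : R) : {fset R} := fset_set (L `&` [set y | y <= X]).

Lemma mem_upto X x : (x \in upto X) = `[< L x /\ x <= X >].
Proof.
rewrite in_fset_set; last exact: finite_L_le.
by apply/idP/asboolP => [/set_mem|/mem_set].
Qed.

Lemma upto_L X x : x \in upto X -> L x.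
Proof. by rewrite mem_upto => /asboolP[]. Qed.

Definition tail_le (X e : R) := forall s : seq R, uniq s ->
  (forall x, x \in s -> L x /\ X < x) -> \sum_(x <- s) x^-1 <= e.

Lemma tail_le_mono X Y e : X <= Y -> tail_le X e -> tail_le Y e.
Proof.
move=> XY hX s us hs; apply: hX => // x /hs [Lx Yx]; split=> //.
exact: le_lt_trans Yx.
Qed.

(** Choose X above a finite list whose sum is within e of the supremum; a list beyond X is disjoint
    from it, so its sum is at most e. *)
Lemma tail_small (e : R) : 0 < e -> exists X : nat, tail_le X%:R e.
Proof.
move=> e0; have [C hC] := Lsum.
pose S := [set y | exists s : seq R,
  [/\ uniq s, forall x, x \in s -> L x & y = \sum_(x <- s) x^-1]].
have supS : has_sup S.
  split; first by exists 0; exists [::]; split=> //; rewrite big_nil.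
  by exists C => _ [s [us sL ->]]; apply: hC.
have [_ [s0 [us0 s0L ->]] hs0] := sup_adherent e0 supS.
exists (Num.truncn (\sum_(x <- s0) x)).+1 => s us hs.
have big x : x \in s0 -> x < (Num.truncn (\sum_(x <- s0) x)).+1%:R.
  move=> xs; apply: le_lt_trans (real_truncnS_gt (num_real _)).
  rewrite (bigD1_seq x) //= lerDl big_seq_cond sumr_ge0 // => y /andP[/s0L /Lgt0 y0 _].
  exact: ltW.
have : \sum_(x <- s0 ++ s) x^-1 <= sup S.
  apply: sup_upper_bound => //; exists (s0 ++ s); split=> //.
    rewrite cat_uniq us0 us andbT /=; apply/hasPn => x /hs[_ Xx] /=.
    by apply/negP => /big /(lt_trans Xx); rewrite ltxx.
  by move=> x; rewrite mem_cat => /orP[/s0L|/hs[]].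
rewrite big_cat /=; move: hs0.
by move: (\sum_(x <- s0) x^-1) (\sum_(x <- s) x^-1) (sup S) => a b c; lra.
Qed.

Definition far (X : R) (n : nat) := exists x, [/\ L x, X < x & hit x n \/ hit x n.+1].

(** A union bound over the x with X < x <= N + 2; a larger x has no positive multiple in the windows
    concerned. The factor 2 accounts for the two windows. *)
Lemma count_far X e (N : nat) : tail_le X e ->
  \sum_(n < N) (`[< far X n.+1 >])%:R <= 2 * N.+2%:R * e.
Proof.
move=> hX; pose s := [seq x <- upto N.+2%:R | X < x].
have us : uniq s by rewrite filter_uniq // fset_uniq.
have sL x : x \in s -> L x /\ X < x.
  by rewrite mem_filter => /andP[? /upto_L].
apply: (@le_trans _ _ (\sum_(x <- s) 2 * (N.+2%:R / x))); last first.
  rewrite -mulr_sumr -mulr_sumr mulrA ler_wpM2l ?mulr_ge0 //; exact: hX.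
apply: (@le_trans _ _ (\sum_(n < N) \sum_(x <- s) ((`[< hit x n.+1 >])%:R + (`[< hit x n.+2 >])%:R))).
  apply: ler_sum => n _; case: asboolP => [[x [Lx Xx hx]]|_]; last first.
    by rewrite sumr_ge0 // => x _; rewrite addr_ge0.
  have xs : x \in s.
    rewrite mem_filter Xx mem_upto; apply/asboolP; split=> //.
    have {}hx : x < n.+3%:R.
      case: hx => /(hit_lt (Lgt0 Lx)) // /lt_le_trans; apply; by rewrite ler_nat.
    by apply: ltW; apply: lt_le_trans hx _; rewrite ler_nat !ltnS ltn_ord.
  rewrite (bigD1_seq x) //=.
  have : 0 <= \sum_(y <- s | y != x) ((`[< hit y n.+1 >])%:R + (`[< hit y n.+2 >])%:R) :> R.
    by rewrite sumr_ge0 // => y _; rewrite addr_ge0.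
  move: (\sum_(y <- s | _) _) => z z0.
  have : 1 <= (`[< hit x n.+1 >])%:R + (`[< hit x n.+2 >])%:R :> R.
    by case: hx => h; rewrite (asboolT h) ?lerDl ?lerDr.
  by move: (_%:R + _) => w; lra.
rewrite exchange_big /= big_seq [X in _ <= X]big_seq; apply: ler_sum => x /sL[Lx _].
rewrite big_split /= mulr2n mulrDl mul1r.
apply: lerD; apply: le_trans (count_hit_le N.+2 (Lgt0 Lx)).
  rewrite [X in _ <= X]big_ord_recl [X in _ <= _ + X]big_ord_recr /=.
  by rewrite addrCA lerDl addr_ge0.
by rewrite [X in _ <= X]big_ord_recl [X in _ <= _ + X]big_ord_recl /= addrA lerDr addr_ge0.
Qed.

Definition hits (n : nat) : {fset R} := fset_set [set x | L x /\ hit x n].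

Lemma mem_hits n x : (x \in hits n) = `[< L x /\ hit x n >].
Proof.
rewrite in_fset_set; first by apply/idP/asboolP => [/set_mem|/mem_set].
apply: sub_finite_set (finite_L_le n.+1%:R).
by move=> y /= [Ly hy]; split=> //=; apply: ltW; apply: hit_lt => //; apply: Lgt0.
Qed.

Lemma hits_disjoint n : [disjoint hits n & hits n.+1]%fset.
Proof.
apply/fdisjointP => x; rewrite !mem_hits => /asboolP[Lx h1]; apply/negP => /asboolP[_].
exact: hit_disjoint (L2 Lx) h1.
Qed.

(** * The infinite product of the factors 1 - 2/lambda *)

Definition partial_tail (G : set R) (X : nat) : R :=
  \big[*%R/1%R]_(l \in (L `\` G) `&` [set y | y <= X%:R]) (1 - 2 / l).

(** Indexing by the longer list [upto Y] allows products with different cutoffs to be compared. *)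
Lemma partial_tailE G (X Y : nat) : (X <= Y)%N -> partial_tail G X =
  \prod_(x <- upto Y%:R | ~~ `[< G x >] && (x <= X%:R)) (1 - 2 / x).
Proof.
move=> XY; have fin : finite_set ((L `\` G) `&` [set y | y <= X%:R]).
  by apply: sub_finite_set (finite_L_le X%:R) => y [[Ly _] yX]; split.
rewrite /partial_tail fsbig_finite //= -[RHS]big_filter.
apply: perm_big; apply: uniq_perm; rewrite ?filter_uniq ?fset_uniq // => x.
rewrite in_fset_set // mem_filter mem_upto; apply/idP/idP => [/set_mem [[Lx Gx] /= xX]|].
  rewrite asboolF // xX /=; apply/asboolP; split=> //.
  by apply: le_trans xX _; rewrite ler_nat.
by move=> /andP[/andP[/asboolP Gx xX] /asboolP[Lx _]]; apply/mem_set.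
Qed.

Lemma factor_bounds x : L x -> 0 < 1 - 2 / x <= 1.
Proof.
move=> Lx; have x2 := L2 Lx; have x0 := Lgt0 Lx.
have : x^-1 < 2^-1 by rewrite ltf_pV2 ?posrE.
have : 0 < x^-1 by rewrite invr_gt0.
by move=> *; apply/andP; split; lra.
Qed.

Lemma partial_tail_gt0 G X : 0 < partial_tail G X.
Proof.
rewrite (partial_tailE G (leqnn X)) big_seq_cond; apply: prodr_gt0 => x /andP[xs _].
by have /andP[] := factor_bounds (upto_L xs).
Qed.

Lemma partial_tail_split G (X Y : nat) : (X <= Y)%N -> partial_tail G Y =
  partial_tail G X * \prod_(x <- upto Y%:R | ~~ `[< G x >] && (X%:R < x)) (1 - 2 / x).
Proof.
move=> XY; rewrite (partial_tailE G (leqnn Y)) (partial_tailE G XY).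
rewrite (bigID (fun x => x <= X%:R)) /=; congr (_ * _).
  apply: eq_bigl => x; rewrite -andbA; congr (_ && _).
  case: (leP x X%:R) => xX; rewrite ?andbF ?andbT //.
  by apply: le_trans xX _; rewrite ler_nat.
rewrite big_seq_cond [RHS]big_seq_cond; apply: eq_bigl => x; rewrite mem_upto -ltNge.
case: asboolP => [[_ xY]|//] /=.
by rewrite xY andbT.
Qed.

Lemma nonincreasing_partial_tail G : nonincreasing_seq (partial_tail G).
Proof.
move=> X Y XY; rewrite (partial_tail_split G XY) ler_piMr //.
  exact: ltW (partial_tail_gt0 _ _).
rewrite big_seq_cond; apply: prodr_ile1 => x /andP[/upto_L /factor_bounds /andP[? ?] _].
by apply/andP; split=> //; apply: ltW.
Qed.

Lemma is_cvg_partial_tail G : cvgn (partial_tail G).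
Proof.
apply: nonincreasing_is_cvgn; first exact: nonincreasing_partial_tail.
by exists 0 => _ [X _ <-]; apply: ltW (partial_tail_gt0 _ _).
Qed.

(** The Weierstrass product inequality, valid because all factors lie in [0, 1]. *)
Lemma prod_factors_ge (s : seq R) : (forall x, x \in s -> L x) ->
  1 - 2 * \sum_(x <- s) x^-1 <= \prod_(x <- s) (1 - 2 / x).
Proof.
elim: s => [|x s IH] sL; first by rewrite !big_nil mulr0 subr0.
have sL' y : y \in s -> L y by move=> ys; apply: sL; rewrite inE ys orbT.
have {}IH := IH sL'.
have Lx : L x by apply: sL; rewrite mem_head.
have /andP[f0 f1] := factor_bounds Lx.
have x0 : 0 < x^-1 by rewrite invr_gt0 Lgt0.
have p1 : \prod_(x <- s) (1 - 2 / x) <= 1.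
  rewrite big_seq; apply: prodr_ile1 => y /sL' /factor_bounds /andP[? ?].
  by apply/andP; split=> //; apply: ltW.
rewrite !big_cons; move: IH p1.
move: (\sum_(x <- s) x^-1) (\prod_(x <- s) (1 - 2 / x)) => S P IH p1.
have : 0 <= x^-1 * (1 - P) by rewrite mulr_ge0 ?subr_ge0 // ltW.
by lra.
Qed.

(** Beyond a cutoff with tail sum at most 1/4, the remaining product never drops below 1 - 2/4. *)
Lemma partial_tail_lim_gt0 G : 0 < limn (partial_tail G).
Proof.
have [|X hX] := @tail_small 4^-1; first by rewrite invr_gt0.
apply: (@lt_le_trans _ _ (partial_tail G X / 2)).
  by rewrite divr_gt0 ?partial_tail_gt0.
apply: limr_ge; first exact: is_cvg_partial_tail.
near=> Y; have XY : (X <= Y)%N by near: Y; exact: nbhs_infty_ge.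
rewrite (partial_tail_split G XY) ler_pM2l ?partial_tail_gt0 //.
rewrite -big_filter; set s := [seq _ <- _ | _].
have sL x : x \in s -> L x /\ X%:R < x.
  by rewrite mem_filter => /andP[/andP[_ ?] /upto_L].
apply: le_trans (prod_factors_ge (fun x xs => (sL x xs).1)).
have := hX s _ sL; rewrite filter_uniq ?fset_uniq // => /(_ isT).
by move: (\sum_(x <- s) _) => S; lra.
Unshelve. all: by end_near. Qed.

Lemma hit_class1 (x : R) n : (hit_class x n == inord 1) = `[< hit x n >].
Proof.
rewrite /hit_class; case: asboolP => _; first by rewrite eqxx.
by case: asboolP => _; rewrite -val_eqE /= ?inordK.
Qed.

Lemma hit_class2 (x : R) n : (hit_class x n == inord 2) = ~~ `[< hit x n >] && `[< hit x n.+1 >].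
Proof.
rewrite /hit_class; case: asboolP => _; first by rewrite -val_eqE /= !inordK.
by case: asboolP => _; rewrite ?eqxx // -val_eqE /= inordK.
Qed.

(** The event implies that every lambda <= X has its prescribed class ([C]), and conversely [C]
    implies the event unless n is far. [C] has mean q times a partial product, which tends to the
    claimed value as X grows. *)
Lemma hits_mean (I J : {fset R}) : [set` I] `<=` L -> [set` J] `<=` L ->
  [disjoint I & J]%fset ->
  has_mean (fun n => ((hits n, hits n.+1) == (I, J))%:R)
    ((\prod_(x <- (I `|` J)%fset) x^-1) * limn (partial_tail ([set` I] `|` [set` J]))).
Proof.
move=> IL JL IJ; set G := [set` I] `|` [set` J]; set q := \prod_(x <- _) _.
have cvq : (fun X => q * partial_tail G X) @ \oo --> q * limn (partial_tail G).
  by apply: cvgM; [exact: cvg_cst|exact: is_cvg_partial_tail].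
apply/cvgrPdist_le => e e0.
(* By [count_far] and N + 2 <= 3N, the far n have frequency at most 6e/24 = e/4. *)
have [|X0 hX0] := @tail_small (e / 24); first by rewrite divr_gt0.
move/cvgrPdist_le : cvq => /(_ (e / 4)) [|X1 _ hX1]; first by rewrite divr_gt0.
have [X2 hX2] : exists X2 : nat, forall x, x \in (I `|` J)%fset -> x <= X2%:R.
  exists (Num.truncn (\sum_(x <- (I `|` J)%fset) x)).+1 => x xs.
  apply: le_trans (ltW (real_truncnS_gt (num_real _))).
  rewrite (bigD1_seq x) //= lerDl big_seq_cond sumr_ge0 // => y /andP[+ _].
  by rewrite in_fsetU => /orP[/IL|/JL] /Lgt0 /ltW.
pose X := maxn X0 (maxn X1 X2).
have X0X : (X0 <= X)%N by rewrite leq_maxl.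
have X1X : (X1 <= X)%N by rewrite (leq_trans (leq_maxl X1 X2)) ?leq_maxr.
have X2X : (X2 <= X)%N by rewrite (leq_trans (leq_maxr X1 X2)) ?leq_maxr.
have hX : tail_le X%:R (e / 24) by apply: tail_le_mono hX0; rewrite ler_nat.
have IJX x : x \in (I `|` J)%fset -> x \in upto X%:R.
  move=> xIJ; rewrite mem_upto; apply/asboolP; split.
    by move: xIJ; rewrite in_fsetU => /orP[/IL|/JL].
  by apply: le_trans (hX2 _ xIJ) _; rewrite ler_nat.
pose f x : 'I_3 := if x \in I then inord 1 else if x \in J then inord 2 else ord0.
have pX : \prod_(x <- upto X%:R) class_size x (f x) = q * partial_tail G X.
  rewrite (bigID (mem (I `|` J)%fset)) /=; congr (_ * _).
    rewrite -big_filter /q.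
    have -> : \prod_(x <- (I `|` J)%fset) x^-1 = \prod_(x <- (I `|` J)%fset) class_size x (f x).
      apply: eq_big_seq => x; rewrite in_fsetU /f /class_size.
      by case: (x \in I) => /= [_|->]; rewrite -val_eqE /= inordK.
    apply: perm_big; apply: uniq_perm; rewrite ?filter_uniq ?fset_uniq // => x.
    by rewrite mem_filter /=; case: (boolP (x \in (I `|` J)%fset)) => //= h; rewrite IJX.
  rewrite (partial_tailE G (leqnn X)) big_seq_cond [RHS]big_seq_cond.
  have GE x : `[< G x >] = (x \in (I `|` J)%fset).
    by rewrite in_fsetU; apply/asboolP/orP.
  apply: eq_big => x; last first.
    by move=> /andP[_]; rewrite in_fsetU negb_or /f /class_size => /andP[/negPf -> /negPf ->].
  rewrite GE mem_upto; case: asboolP => [[_ ->]|//]; by rewrite andbT.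
have /cvgrPdist_le := @hit_class_mean (upto X%:R) f (fset_uniq (upto X%:R)) (@upto_L X%:R).
move=> /(_ (e / 4)) [|N0 _ hN0]; first by rewrite divr_gt0.
rewrite pX in hN0.
pose C n := all (fun x => hit_class x n == f x) (upto X%:R).
have BC n : (hits n, hits n.+1) = (I, J) -> C n.
  move=> [hI hJ]; apply/allP => x xX; have Lx := upto_L xX.
  have EI : (x \in I) = `[< hit x n >].
    by rewrite -hI mem_hits; apply/asboolP/asboolP => [[]|].
  have EJ : (x \in J) = `[< hit x n.+1 >].
    by rewrite -hJ mem_hits; apply/asboolP/asboolP => [[]|].
  by rewrite /f EI EJ /hit_class eqxx.
have CB n : C n -> ~ far X%:R n -> (hits n, hits n.+1) = (I, J).
  move=> /allP Cn nfar.
  have near_X x : L x -> hit x n \/ hit x n.+1 -> x \in upto X%:R.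
    move=> Lx hx; rewrite mem_upto; apply/asboolP; split=> //.
    by rewrite leNgt; apply/negP => Xx; apply: nfar; exists x.
  have EI x : x \in upto X%:R -> (x \in I) = `[< hit x n >].
    move=> /Cn /eqP E; rewrite -hit_class1 E /f.
    by case: (x \in I); rewrite ?eqxx //; case: (x \in J); rewrite -val_eqE /= ?inordK.
  have EJ x : x \in upto X%:R -> (x \in J) = `[< hit x n.+1 >].
    move=> xX; have Lx := upto_L xX.
    have -> : `[< hit x n.+1 >] = ~~ `[< hit x n >] && `[< hit x n.+1 >].
      case: (asboolP (hit x n)) => //= h; apply/asboolP; exact: hit_disjoint (L2 Lx) h.
    rewrite -hit_class2 (eqP (Cn _ xX)) /f.
    have [xI|xI] := boolP (x \in I).
      by rewrite (negPf (fdisjointP IJ _ xI)) -val_eqE /= !inordK.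
    by case: (x \in J); rewrite ?eqxx // -val_eqE /= inordK.
  congr (_, _); apply/fsetP => x; rewrite mem_hits; apply/asboolP/idP.
  - by move=> [Lx h]; rewrite EI ?asboolT //; apply: near_X => //; left.
  - move=> xI; have xX : x \in upto X%:R by rewrite IJX // in_fsetU xI.
    by move: xI; rewrite EI // => /asboolP; split=> //; apply: upto_L xX.
  - by move=> [Lx h]; rewrite EJ ?asboolT //; apply: near_X => //; right.
  - move=> xJ; have xX : x \in upto X%:R by rewrite IJX // in_fsetU xJ orbT.
    by move: xJ; rewrite EJ // => /asboolP; split=> //; apply: upto_L xX.
exists N0.+1 => // N /= NN0.
have N1 : (0 < N)%N by apply: leq_trans NN0.
have NR : 0 < N%:R :> R by rewrite ltr0n.
have h1 := hX1 X X1X; have h2 := hN0 N (ltnW NN0).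
have h3 : (\sum_(n < N) (`[< far X%:R n.+1 >])%:R) / N%:R <= e / 4 :> R.
  rewrite ler_pdivrMr //; apply: le_trans (count_far N hX) _.
  have : N.+2%:R <= 3 * N%:R :> R by rewrite -natrM ler_nat; lia.
  move=> h; have : 0 <= (3 * N%:R - N.+2%:R) * e by rewrite mulr_ge0 ?subr_ge0 // ltW.
  by lra.
have h4 : (\sum_(n < N) ((hits n.+1, hits n.+2) == (I, J))%:R) / N%:R <=
    (\sum_(n < N) (C n.+1)%:R) / N%:R :> R.
  rewrite ler_pM2r ?invr_gt0 //; apply: ler_sum => n _.
  by case: eqP => // /BC ->.
have h5 : (\sum_(n < N) (C n.+1)%:R) / N%:R <=
    (\sum_(n < N) ((hits n.+1, hits n.+2) == (I, J))%:R) / N%:R +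
    (\sum_(n < N) (`[< far X%:R n.+1 >])%:R) / N%:R :> R.
  rewrite -mulrDl ler_pM2r ?invr_gt0 // -big_split; apply: ler_sum => n _ /=.
  case: (boolP (C n.+1)) => [Cn|_]; last by rewrite addr_ge0.
  case: asboolP => [_|/(CB _ Cn) ->]; first by rewrite lerDr.
  by rewrite eqxx lerDl.
move: h1 h2 h3 h4 h5; rewrite -/(C _).
move: ((\sum_(n < N) (C n.+1)%:R) / N%:R) => c.
move: ((\sum_(n < N) ((hits n.+1, hits n.+2) == (I, J))%:R) / N%:R) => b.
move: ((\sum_(n < N) (`[< far X%:R n.+1 >])%:R) / N%:R) (q * limn _) (q * partial_tail _ _) => a d g.
rewrite !ler_norml => /andP[? ?] /andP[? ?] ? ? ?; apply/andP; split; lra.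
Qed.

End SparseSet.

(** * Densities of A and B *)

(** Averages start at index 1, and the descriptions of [Aset] and [Bset] by [hits] are stated for
    positive n only. *)
Lemma has_mean_eqS (R : realType) (u v : nat -> R) c :
  (forall n, u n.+1 = v n.+1) -> has_mean u c -> has_mean v c.
Proof.
move=> uv; rewrite /has_mean.
by under eq_fun do under eq_bigr do rewrite uv.
Qed.

Lemma has_mean_density (R : realType) (A : nat -> Prop) (d : R) :
  has_mean (fun n => (`[< A n >])%:R) d -> has_density A d.
Proof.
rewrite /has_mean /has_density.
suff -> : (fun N => (count (fun j => `[< A j >]) (iota 1 N))%:R / N%:R) =
  (fun N => (\sum_(n < N) (`[< A n.+1 >])%:R) / N%:R) :> (nat -> R) by [].
apply/funext => N; congr (_ / _); rewrite -natr_sum; congr _%:R.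
rewrite -sum1_count big_mkcond /= -[iota 1 N]/(iota (1 + 0) N) iotaDl big_map.
rewrite -{1}[N]subn0 -/(index_iota 0 N) big_mkord.
by apply: eq_bigr => n _; rewrite add1n; case: (`[< _ >]).
Qed.

Section Windows.
Variables (R : realType) (k : nat).
Hypothesis k2 : (2 <= k)%N.

Notation Lam := (@Lambda R k).
Let L2 := @Lambda_gt2 R k k2.
Let Lsum := @Lambda_inv_summable R k k2.
Let Lind := @Lambda_inv_indep R k k2.
Let k0 : (0 < k)%N. Proof. exact: ltnW. Qed.
Let Lgt0 x : Lam x -> 0 < x.
Proof. by move=> /L2; lra. Qed.

Let mem_hitsL := mem_hits L2 Lsum.
Let hits_disjointL := hits_disjoint L2 Lsum.

Lemma Lambda_natX x (a : nat) : Lam x -> exists j : nat, j%:R = (a%:R * x) ^+ k.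
Proof.
move=> /(Lambda_root_of k2) [N [_ xk _ _] _]; exists (a ^ k * N)%N.
by rewrite exprMn xk natrM natrX.
Qed.

Lemma pow_between (y : R) (m n j : nat) : 0 <= y -> j%:R = y ^+ k ->
  (m ^ k < j < n ^ k)%N = (m%:R < y < n%:R).
Proof.
move=> y0 jy; rewrite -!(ltr_nat R) jy !natrX.
by rewrite !(ltr_pXn2r k0) ?nnegrE.
Qed.

Lemma multiple_inj x y (a b : nat) : Lam x -> Lam y -> (0 < a)%N -> a%:R * x = b%:R * y -> x = y.
Proof.
move=> Lx Ly a0 E.
have [N hx _] := Lambda_root_of k2 Lx; have [M hy _] := Lambda_root_of k2 Ly.
have NM : N = M.
  apply: (root_of_ratio k2 hx hy); exists (b%:R / a%:R).
  have y0 : y != 0 by rewrite gt_eqF ?Lgt0.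
  have a0' : a%:R != 0 :> R by rewrite pnatr_eq0 -lt0n.
  by rewrite fmorph_div /= !ratr_nat; apply/eqP; rewrite eqr_div // mulrC E.
move: hx hy => [x0 xk _ _] [y0 yk _ _].
by apply: (pexpIrn k0); rewrite ?nnegrE ?ltW // xk yk NM.
Qed.

Lemma multiple_not_nat x (a n : nat) : Lam x -> a%:R * x <> n.+1%:R.
Proof.
move=> Lx; have [N hx N2] := Lambda_root_of k2 Lx => E.
have a0 : a%:R != 0 :> R.
  by apply: contra_eq_neq E => ->; rewrite mul0r eq_sym pnatr_eq0.
have : N = 1%N.
  apply: (root_of_ratio k2 hx (root_of1 R k)); exists (n.+1%:R / a%:R).
  by rewrite fmorph_div /= !ratr_nat divr1 -E [a%:R * x]mulrC mulfK.
by move=> N1; move: N2; rewrite N1 ltnNge expn_gt0.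
Qed.

(** The bijection sends x to (a x)^k, where a x is the multiple in the window: it is unique because
    x > 2, and distinct x give distinct values because their ratio is irrational. *)
Lemma cnt_open_card (M : set R) n : M `<=` Lam ->
  cnt_open (n ^ k) (n.+1 ^ k) (S_of k M) = #|` fset_set [set x | M x /\ hit x n]|%fset.
Proof.
move=> ML; set H := fset_set _.
have memH x : (x \in H) = `[< M x /\ hit x n >].
  rewrite in_fset_set; first by apply/idP/asboolP => [/set_mem|/mem_set].
  apply: sub_finite_set (finite_L_le L2 Lsum n.+1%:R) => y [/ML Ly hy]; split=> //=.
  by apply: ltW; apply: hit_lt => //; apply: Lgt0.
have ex_j x : exists aj : nat * nat, x \in H ->
    [/\ aj.2%:R = (aj.1%:R * x) ^+ k & n%:R < aj.1%:R * x < n.+1%:R].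
  have [xH|] := boolP (x \in H); last by exists (0, 0)%N.
  move: (xH); rewrite memH => /asboolP[/ML Lx [a ha]].
  by have [j hj] := Lambda_natX a Lx; exists (a, j).
have [g hg] := choice ex_j.
rewrite /cnt_open -size_filter; set J := [seq j <- _ | _].
have memJ j : (j \in J) = `[< S_of k M j >] && (n ^ k < j < n.+1 ^ k)%N.
  rewrite mem_filter mem_iota; congr (_ && _).
  by rewrite subnKC // ltn_exp2r.
suff : perm_eq J [seq (g x).2 | x <- H] by move=> /perm_size; rewrite size_map.
have uniq_mult x (a b : nat) : Lam x -> n%:R < a%:R * x < n.+1%:R ->
    n%:R < b%:R * x < n.+1%:R -> (a <= b)%N.
  move=> Lx /andP[a1 a2] /andP[b1 b2]; rewrite leqNgt; apply/negP => ba.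
  have x2 := L2 Lx.
  have : b.+1%:R * x <= a%:R * x by rewrite ler_pM2r ?Lgt0 ?ler_nat.
  by move: a2 b1; rewrite -!natr1 mulrDl mul1r; lra.
apply: uniq_perm.
- by rewrite filter_uniq ?iota_uniq.
- rewrite map_inj_in_uniq ?fset_uniq // => x y xH yH E.
  have [jx ax] := hg _ xH; have [jy ay] := hg _ yH.
  have Lx : Lam x by move: xH; rewrite memH => /asboolP[/ML].
  have Ly : Lam y by move: yH; rewrite memH => /asboolP[/ML].
  apply: (@multiple_inj x y (g x).1 (g y).1) => //.
    rewrite lt0n; apply: contraTneq ax => ->.
    by rewrite mul0r ltNge ler0n.
  have x0 : 0 <= (g x).1%:R * x by rewrite mulr_ge0 // ltW // Lgt0.
  have y0 : 0 <= (g y).1%:R * y by rewrite mulr_ge0 // ltW // Lgt0.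
  by apply: (pexpIrn k0); rewrite ?nnegrE // -jx -jy E.
- move=> j; rewrite memJ; apply/andP/mapP.
    move=> [/asboolP[a [a0 [x Mx jx]]]]; have Lx := ML _ Mx.
    rewrite (pow_between _ _ _ jx); last by rewrite mulr_ge0 // ltW ?Lgt0.
    move=> ha.
    have xH : x \in H by rewrite memH; apply/asboolP; split=> //; exists a.
    exists x => //; have [gx hgx] := hg _ xH.
    apply/eqP; rewrite -(eqr_nat R) gx jx; apply/eqP; congr ((_%:R * _) ^+ _).
    by apply/eqP; rewrite eqn_leq (uniq_mult x) // (uniq_mult x).
  move=> [x xH ->]; have [gx hgx] := hg _ xH.
  have Mx : M x by move: xH; rewrite memH => /asboolP[].
  have a0 : (0 < (g x).1)%N.
    rewrite lt0n; apply: contraTneq hgx => ->.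
    by rewrite mul0r ltNge ler0n.
  split; last by rewrite (pow_between _ _ _ gx) // mulr_ge0 // ltW // Lgt0 //; apply: ML.
  by apply/asboolP; exists (g x).1; split=> //; exists x.
Qed.

Notation P n := (hits Lam n, hits Lam n.+1).

(** The disjointness demanded by [IJpairs] is automatic, as no lambda > 2 hits two consecutive
    windows. *)
Lemma Aset_hits l m n : Aset k l m n.+1 <-> @IJpairs R k l m (P n.+1).
Proof.
have E i : cnt_open (i ^ k) (i.+1 ^ k) (Sk k) = #|` hits Lam i|%fset.
  rewrite -cnt_open_card //; apply: eq_count => j; apply: asbool_equiv_eq.
  by split; [exact: Sk_S_of | exact: S_of_Sk].
have HL i : [set` hits Lam i] `<=` Lam.
  by move=> x /=; rewrite mem_hitsL => /asboolP[].
rewrite /Aset !E /IJpairs /=; split; first by move=> [_ [? ?]].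
by move=> [_ [_ [? [? _]]]].
Qed.

(** The two counts say that I and J are contained in the respective hit sets, and the emptiness
    condition that both hit sets lie in their union. Disjointness of consecutive hit sets then
    separates I from J. *)
Lemma Bset_hits (I J : {fset R}) n : [set` I] `<=` Lam -> [set` J] `<=` Lam ->
  Bset k I J n.+1 <-> P n.+1 = (I, J).
Proof.
move=> IL JL.
have card_sub (F : {fset R}) i : [set` F] `<=` Lam ->
    (cnt_open (i ^ k) (i.+1 ^ k) (S_of k [set` F]) = #|` F|%fset) <-> (F `<=` hits Lam i)%fset.
  move=> FL; rewrite cnt_open_card //.
  have -> : fset_set [set x | [set` F] x /\ hit x i] = (F `&` hits Lam i)%fset.
    apply/fsetP => x; rewrite in_fsetI mem_hitsL in_fset_set; last first.
      by apply: sub_finite_set (finite_fset F) => y [].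
    apply/idP/andP => [/set_mem [xF hx]|[xF /asboolP[_ hx]]]; last exact/mem_set.
    by split=> //; apply/asboolP; split=> //; apply: FL.
  split=> [E|/fsetIidPl -> //].
  by apply/fsetIidPl/eqP; rewrite eqEfcard fsubsetIl E leqnn.
have mult x i : Lam x -> hit x i -> exists a j : nat,
    [/\ (0 < a)%N, j%:R = (a%:R * x) ^+ k & (i ^ k < j < i.+1 ^ k)%N].
  move=> Lx [a ha]; have [j hj] := Lambda_natX a Lx; exists a, j; split=> //.
    by rewrite lt0n; apply: contraTneq ha => ->; rewrite mul0r ltNge ler0n.
  by rewrite (pow_between _ _ _ hj) // mulr_ge0 // ltW // Lgt0.
rewrite /Bset; split.
  move=> [_ [/(card_sub _ _ IL) sI [/(card_sub _ _ JL) sJ no]]].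
  have none x i : Lam x -> hit x i -> (i == n.+1) || (i == n.+2) -> (x \in I) || (x \in J).
    move=> Lx hx hi; apply: contraT; rewrite negb_or => /andP[xI xJ]; exfalso.
    have [a [j [a0 hj /andP[j1 j2]]]] := mult _ _ Lx hx.
    apply: (no j); last first.
      by exists a; split=> //; exists x => //; split=> // -[]; apply/negP.
    case/orP: hi j1 j2 => /eqP -> j1 j2; apply/andP; split=> //.
      by apply: (leq_trans j2); rewrite leq_exp2r.
    by apply: leq_ltn_trans j1; rewrite leq_exp2r.
  have disj := fdisjointP (hits_disjointL n.+1).
  congr (_, _); apply/eqP; rewrite eqEfsubset ?sI ?sJ andbT; apply/fsubsetP => x xh.
    move: (xh); rewrite mem_hitsL => /asboolP[Lx hx].
    have := none _ _ Lx hx; rewrite eqxx => /(_ isT) /orP[//|].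
    by move=> /(fsubsetP sJ) h; have := disj _ xh; rewrite h.
  move: (xh); rewrite mem_hitsL => /asboolP[Lx hx].
  have := none _ _ Lx hx; rewrite eqxx orbT => /(_ isT) /orP[|//].
  by move=> /(fsubsetP sI) h; have := disj _ h; rewrite xh.
move=> [hI hJ]; split=> //; split; first by apply/card_sub => //; rewrite hI.
split; first by apply/card_sub => //; rewrite hJ.
move=> j jj [a [a0 [x [Lx xIJ] hj]]].
have := jj; rewrite (pow_between _ _ _ hj); last by rewrite mulr_ge0 // ltW // Lgt0.
move=> /andP[h1 h2]; apply: xIJ.
(* The emptiness condition also covers the middle point between the windows, which no multiple of a
   lambda can equal. *)
case: (ltgtP (a%:R * x) n.+2%:R) => h; last by case: (multiple_not_nat Lx h).
  by left; rewrite /= -hI mem_hitsL; apply/asboolP; split=> //; exists a; rewrite h1.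
by right; rewrite /= -hJ mem_hitsL; apply/asboolP; split=> //; exists a; rewrite h.
Qed.

Lemma term_gt0 (I J : {fset R}) : [set` I] `<=` Lam -> [set` J] `<=` Lam -> 0 < term k I J.
Proof.
move=> IL JL; rewrite mulr_gt0 //; last exact: (partial_tail_lim_gt0 L2 Lsum).
rewrite big_seq prodr_gt0 // => x; rewrite in_fsetU invr_gt0 => /orP[/IL|/JL]; exact: Lgt0.
Qed.

(** One admissible pair suffices for d > 0, since its term is positive; Lambda, being infinite, has
    room for l + m distinct elements. *)
Lemma IJpairs_nonempty l m : @IJpairs R k l m !=set0.
Proof.
have [B BL sz] := infinite_set_fset (l + m) (@Lambda_infinite R k k2).
have [s sE] : exists s : seq R, s = B by exists B.
have us : uniq s by rewrite sE fset_uniq.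
have sL x : x \in s -> Lam x by rewrite sE => /BL.
have {}sz : (l + m <= size s)%N by rewrite sE.
have lsz : (l <= size s)%N by apply: leq_trans sz; rewrite leq_addr.
have ul : uniq (take l s) by rewrite take_uniq.
have um : uniq (take m (drop l s)) by rewrite take_uniq ?drop_uniq.
exists ([fset x in take l s]%fset, [fset x in take m (drop l s)]%fset).
split; first by move=> x /=; rewrite in_fset => /mem_take /sL.
split; first by move=> x /=; rewrite in_fset => /mem_take /mem_drop /sL.
split; first by rewrite /= card_fseq undup_id // size_takel.
split; first by rewrite /= card_fseq undup_id // size_takel // size_drop leq_subRL.
apply/fdisjointP => x /=; rewrite !in_fset => xl; apply/negP => /mem_take xd.
move: us; rewrite -(cat_take_drop l s) cat_uniq => /and3P[_ /hasPn /(_ _ xd) /= + _].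
by rewrite xl.
Qed.

(** [K] consists of all pairs of subsets of the lambda up to X, so leaving [K] makes n far. The tail
    e/6 yields 2(N + 2)e/6 <= eN. *)
Lemma hits_tight (e : R) : 0 < e -> exists K : seq ({fset R} * {fset R}),
  \forall N \near \oo, \sum_(n < N) (P n.+1 \notin K)%:R <= e * N%:R.
Proof.
move=> e0; have [|X hX] := @tail_small R Lam L2 Lsum (e / 6); first by rewrite divr_gt0.
pose F := fpowerset (upto Lam X%:R).
exists [seq (A, B) | A <- enum_fset F, B <- enum_fset F].
exists 1%N => // N /= N1.
apply: (@le_trans _ _ (\sum_(n < N) (`[< far Lam X%:R n.+1 >])%:R)); last first.
  apply: le_trans (count_far L2 Lsum N hX) _.
  have : N.+2%:R <= 3 * N%:R :> R by rewrite -natrM ler_nat; lia.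
  move=> h; have : 0 <= (3 * N%:R - N.+2%:R) * e by rewrite mulr_ge0 ?subr_ge0 // ltW.
  by lra.
apply: ler_sum => n _; case: asboolP => [_|nfar]; first by case: (_ \notin _).
rewrite (_ : _ \notin _ = false) //; apply/negbF/allpairsP; exists (P n.+1).
have sub i : (i == n.+1) || (i == n.+2) -> hits Lam i \in F.
  move=> hi; rewrite fpowersetE; apply/fsubsetP => x.
  rewrite mem_hitsL (mem_upto L2 Lsum) => /asboolP[Lx hx]; apply/asboolP; split=> //.
  rewrite leNgt; apply/negP => Xx; apply: nfar; exists x; split=> //.
  by case/orP: hi hx => /eqP ->; [left|right].
by split=> //; apply: sub; rewrite eqxx ?orbT.
Qed.

End Windows.

Theorem theorem2 (R : realType) (k l m : nat) : (2 <= k)%N ->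
  exists d : R,
    0 < d /\
    has_density (Aset k l m) d /\
    (\esum_(IJ in @IJpairs R k l m) (term k IJ.1 IJ.2)%:E)%E = d%:E /\
    (forall IJ, @IJpairs R k l m IJ -> has_density (Bset k IJ.1 IJ.2) (term k IJ.1 IJ.2)).
Proof.
move=> k2.
have L2 := @Lambda_gt2 R k k2; have Lsum := @Lambda_inv_summable R k k2.
have Lind := @Lambda_inv_indep R k k2.
pose P n := (hits (@Lambda R k) n, hits (@Lambda R k) n.+1).
have mean IJ : @IJpairs R k l m IJ -> has_mean (fun n => (P n == IJ)%:R) (term k IJ.1 IJ.2).
  case: IJ => I J [/= IL [JL [_ [_ IJ]]]]; exact: (hits_mean L2 Lind Lsum IL JL IJ).
have [d [md ed vd]] := point_densities mean (hits_tight k2).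
exists d; split; last split; last split.
- have [IJ hIJ] := IJpairs_nonempty R k2 l m.
  by apply: lt_le_trans (vd _ hIJ); have [IL [JL _]] := hIJ; apply: term_gt0.
- apply: has_mean_density; apply: has_mean_eqS md => n; congr (_%:R); congr (nat_of_bool _).
  by apply: asbool_equiv_eq; split => /(Aset_hits R k2).
- exact: ed.
- move=> IJ hIJ; have [IL [JL _]] := hIJ.
  apply: has_mean_density; apply: has_mean_eqS (mean _ hIJ) => n.
  congr (_%:R); congr (nat_of_bool _); apply/eqP/asboolP.
    by move=> E; apply/(Bset_hits k2 n IL JL); rewrite -/(P _) E; case: (IJ).
  by move=> /(Bset_hits k2 n IL JL); rewrite -/(P _) => ->; case: (IJ).
Qed.
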